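(* Regard $UT_2$ as a $UT_2$-algebra with left and right actions given by the usual left and right multiplication. Let $n\ge1$ and let $g\chi_n(UT_2)=\sum_{\lambda\vdash n}m_\lambda\chi_\lambda$ be the $n$th generalized cocharacter of $UT_2$. Then $$m_\lambda=\begin{cases}2n+3,&\text{if }\lambda=(n),\\ 3(q+1),&\text{if }\lambda=(p+q,p)\text{ with }p\ge1,\ q\ge0,\\ q+1,&\text{if }\lambda=(p+q,p,1)\text{ with }p\ge1,\ q\ge0,\\ 0,&\text{in all other cases.}\end{cases}$$
   Context: $F$ is a field of characteristic zero; all algebras are associative $F$-algebras. $UT_2$ is the algebra of $2\times 2$ upper triangular matrices over $F$, with matrix units $e_{ij}$ and basis $\{1=e_{11}+e_{22},\,e_{22},\,e_{12}\}$. Put $W=UT_2$. A $W$-algebra is an algebra $A$ that is a (unital) $W$-bimodule such that $w(a_1a_2)=(wa_1)a_2$, $(a_1a_2)w=a_1(a_2w)$, $(a_1w)a_2=a_1(wa_2)$ for all $w\in W$, $a_1,a_2\in A$. The free $W$-algebra $W\langle X\rangle$ on $X=\{x_1,x_2,\dots\}$ has as $F$-basis the words $w_{0}x_{j_1}w_{1}x_{j_2}\cdots w_{n-1}x_{j_n}w_{n}$, $n\ge 1$, with $w_0,\dots,w_n$ in the basis $\{1,e_{22},e_{12}\}$ of $W$ ($x_i=1x_i=x_i1$), with juxtaposition product and expansion of products of adjacent coefficients in the basis of $W$. For a $W$-algebra $A$, $\mathrm{GId}(A)$ is the set of $f(x_1,\dots,x_n)\in W\langle X\rangle$ with $f(a_1,\dots,a_n)=0$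 for all $a_i\in A$. $GP_n$ is the $F$-span of the elements $w_{0}x_{\sigma(1)}w_{1}\cdots w_{n-1}x_{\sigma(n)}w_{n}$, with $\sigma\in S_n$ and $w_i\in W$, and $GP_n(A)=GP_n/(GP_n\cap\mathrm{GId}(A))$. The symmetric group $S_n$ acts on the left on $GP_n$ by permuting the variables ($x_i\mapsto x_{\sigma(i)}$, coefficients from $W$ fixed in place); this induces an $S_n$-module structure on $GP_n(A)$, whose character $g\chi_n(A)$ is the $n$th generalized cocharacter of $A$. $\chi_\lambda$ is the irreducible $S_n$-character associated with the partition $\lambda\vdash n$, and $m_\lambda$ its multiplicity. *)

(* Defs.v *)
From HB Require Import structures.
From mathcomp Require Import all_boot all_order all_algebra all_fingroup.
From mathcomp Require Import mxrepresentation finmap monalg.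

Set Implicit Arguments.
Unset Strict Implicit.
Unset Printing Implicit Defensive.

Import GRing.Theory.
Local Open Scope ring_scope.

(* Upper triangularity is lower triangularity ([is_trig_mx]) of the transpose. *)
Definition ut2_pred (F : fieldType) : {pred 'M[F]_2} :=
  [pred A : 'M[F]_2 | is_trig_mx A^T].

Fact ut2_closed (F : fieldType) : subalg_closed (@ut2_pred F).
Proof.
have ut2P (A : 'M[F]_2) : reflect (A 1 0 = 0) (A \in @ut2_pred F).
  apply: (iffP is_trig_mxP) => [trigA|A10 i j].
    by rewrite -(trigA 0 1 isT) mxE.
  rewrite mxE; case: i j => [[|[|i]] // lti] [[|[|j]] // ltj] // _.
  by rewrite -A10; congr (A _ _); apply: val_inj.
split=> [|c A B /ut2P A10 /ut2P B10|A B /ut2P A10 /ut2P B10]; apply/ut2P.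
- by rewrite mxE.
- by rewrite !mxE A10 B10 mulr0 addr0.
- by rewrite mxE !big_ord_recl big_ord0 /= A10 mul0r add0r addr0
    (_ : lift 0 0 = 1) ?B10 ?mulr0 //; apply: val_inj.
Qed.

HB.instance Definition _ (F : fieldType) :=
  GRing.isSubalgClosed.Build F 'M[F]_2 (@ut2_pred F)
    (GRing.subalg_closed_semi (@ut2_closed F)).

Record UT2 (F : fieldType) :=
  MkUT2 { ut2_mx :> 'M[F]_2; _ : ut2_mx \in @ut2_pred F }.

HB.instance Definition _ (F : fieldType) := [isSub for @ut2_mx F].
HB.instance Definition _ (F : fieldType) := [Choice of UT2 F by <:].
HB.instance Definition _ (F : fieldType) :=
  [SubChoice_isSubAlgebra of UT2 F by <:].

Lemma ut2_mxD (F : fieldType) (u v : UT2 F) :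
  (u + v : UT2 F) = (u : 'M[F]_2) + v :> 'M[F]_2.
Proof. exact: (raddfD (\val : UT2 F -> 'M[F]_2)). Qed.

Lemma ut2_mxZ (F : fieldType) (c : F) (u : UT2 F) :
  (c *: u : UT2 F) = c *: (u : 'M[F]_2) :> 'M[F]_2.
Proof. exact: (linearZZ (\val : UT2 F -> 'M[F]_2)). Qed.

Lemma ut2_mx1 (F : fieldType) : (1 : UT2 F) = 1 :> 'M[F]_2.
Proof. exact: (rmorph1 (\val : UT2 F -> 'M[F]_2)). Qed.

Lemma ut2_mxM (F : fieldType) (u v : UT2 F) :
  (u * v : UT2 F) = (u : 'M[F]_2) *m v :> 'M[F]_2.
Proof. exact: (rmorphM (\val : UT2 F -> 'M[F]_2)). Qed.

Fact ut2_delta_subproof (F : fieldType) (i : 'I_2) :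
  delta_mx i 1 \in @ut2_pred F.
Proof.
apply/is_trig_mxP => k l ltkl; rewrite !mxE andbC.
by case: eqP ltkl => // ->; rewrite ltnNge -ltnS ltn_ord.
Qed.

Definition ut2_e22 (F : fieldType) : UT2 F := MkUT2 (ut2_delta_subproof F 1).
Definition ut2_e12 (F : fieldType) : UT2 F := MkUT2 (ut2_delta_subproof F 0).

Definition ut2_basis (F : fieldType) (b : 'I_3) : UT2 F :=
  nth 0 [:: 1; ut2_e22 F; ut2_e12 F] b.

Definition ut2_coord (F : fieldType) (b : 'I_3) (w : UT2 F) : F :=
  nth 0 [:: w 0 0; w 1 1 - w 0 0; w 0 1] b.

Lemma ut2_coordE (F : fieldType) (w : UT2 F) :
  w = \sum_b ut2_coord b w *: ut2_basis F b.
Proof.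
have w10 : w 1 0 = 0.
  by have /is_trig_mxP trigw := valP w; rewrite -(trigw 0 1 isT) mxE.
apply: val_inj; rewrite !big_ord_recl big_ord0 addr0.
rewrite -[LHS]/(ut2_mx w) -[RHS]/(ut2_mx _) !ut2_mxD !ut2_mxZ.
rewrite /ut2_basis /ut2_coord /=.
apply/matrixP => i j; rewrite !mxE.
case: i j => [[|[|i]] // lti] [[|[|j]] // ltj]; rewrite ?(mulr1, mulr0);
  rewrite ?(addr0, add0r).
- by congr (w _ _); apply: val_inj.
- by congr (w _ _); apply: val_inj.
- by rewrite -w10; congr (w _ _); apply: val_inj.
- by rewrite addrC subrK; congr (w _ _); apply: val_inj.
Qed.

Lemma ut2_coordP (F : fieldType) (b : 'I_3) (c : F) (u v : UT2 F) :
  ut2_coord b (c *: u + v) = c * ut2_coord b u + ut2_coord b v.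
Proof.
rewrite /ut2_coord ut2_mxD ut2_mxZ !mxE.
by case: b => [[|[|[|b]]] // ltb] /=; rewrite mulrBr opprD addrACA.
Qed.

HB.mixin Record Lmodule_isWAlgebra (F : fieldType) A of GRing.Lmodule F A := {
  wmul : A -> A -> A;
  wlact : UT2 F -> A -> A;
  wract : A -> UT2 F -> A;
  wmul_linearl : forall b : A, linear (wmul^~ b);
  wmul_linearr : forall a : A, linear (wmul a);
  wlact_linearl : forall a : A, linear (wlact^~ a);
  wlact_linearr : forall w : UT2 F, linear (wlact w);
  wract_linearl : forall w : UT2 F, linear (wract^~ w);
  wract_linearr : forall a : A, linear (wract a);
  wmulA : associative wmul;
  wlact1 : forall a : A, wlact 1 a = a;
  wract1 : forall a : A, wract a 1 = a;
  wlactA : forall (u v : UT2 F) (a : A), wlact (u * v) a = wlact u (wlact v a);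
  wractA : forall (a : A) (u v : UT2 F), wract a (u * v) = wract (wract a u) v;
  wlractA : forall (u : UT2 F) (a : A) (v : UT2 F),
    wract (wlact u a) v = wlact u (wract a v);
  wlact_mul : forall (w : UT2 F) (a b : A),
    wlact w (wmul a b) = wmul (wlact w a) b;
  wract_mul : forall (a b : A) (w : UT2 F),
    wract (wmul a b) w = wmul a (wract b w);
  wact_mid : forall (a : A) (w : UT2 F) (b : A),
    wmul (wract a w) b = wmul a (wlact w b)
}.

#[short(type="walgType")]
HB.structure Definition WAlgebra (F : fieldType) :=
  {A of GRing.Lmodule F A & Lmodule_isWAlgebra F A}.

(* UT_2 as a UT_2-algebra: both actions are the multiplication. *)
Section UT2WAlgebra.
Variable F : fieldType.
Implicit Types u v w : UT2 F.

Fact ut2_mul_linearl v : linear (fun u : UT2 F => u * v).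
Proof. by move=> c u1 u2; rewrite mulrDl scalerAl. Qed.

Fact ut2_mul_linearr u : linear (fun v : UT2 F => u * v).
Proof. by move=> c v1 v2; rewrite mulrDr scalerAr. Qed.

HB.instance Definition _ := Lmodule_isWAlgebra.Build F (UT2 F)
  ut2_mul_linearl ut2_mul_linearr ut2_mul_linearl ut2_mul_linearr
  ut2_mul_linearl ut2_mul_linearr (@mulrA _) (@mul1r _) (@mulr1 _)
  (fun u v a => esym (mulrA u v a)) (fun a u v => mulrA a u v)
  (fun u a v => esym (mulrA u a v)) (fun w a b => mulrA w a b)
  (fun a b w => esym (mulrA a b w)) (fun a w b => esym (mulrA a w b)).

End UT2WAlgebra.

(* The word [w_0 x_(j_1) w_1 x_(j_2) ... w_(n-1) x_(j_n) w_n], n >= 1, is       *)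
(* encoded as [((w_0, j_1), [:: (w_1, j_2); ...; (w_(n-1), j_n)], w_n)], an     *)
(* index b : 'I_3 standing for the basis element [ut2_basis F b]; variables are *)
(* numbered from 0.                                                             *)
Definition wword : Type := (('I_3 * nat) * seq ('I_3 * nat) * 'I_3)%type.
HB.instance Definition _ := Choice.on wword.

Definition freeW (F : fieldType) : Type := {malg F[wword]}.
HB.instance Definition _ (F : fieldType) := GRing.Lmodule.on (freeW F).

Definition word (F : fieldType) (k : wword) : freeW F := << k >>.

Section FreeW.
Variable F : fieldType.
Implicit Types (k l m : wword) (f g h : freeW F) (u v w : UT2 F).
Local Notation e := (ut2_basis F).

(* The linear map with prescribed values on a basis, of W<X> and of W. *)
Definition freeW_lift (V : lmodType F) (phi : wword -> V) f : V :=
  \sum_(k <- msupp f) f@_k *: phi k.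

Definition ut2_lift (V : lmodType F) (G : 'I_3 -> V) w : V :=
  \sum_b ut2_coord b w *: G b.

Definition word_mul k l : freeW F :=
  let: (p, s, wn) := k in let: ((v0, j), t, vm) := l in
  ut2_lift (fun b => word F (p, s ++ (b, j) :: t, vm)) (e wn * e v0).

Definition word_lact w k : freeW F :=
  let: ((w0, j), s, wn) := k in
  ut2_lift (fun b => word F ((b, j), s, wn)) (w * e w0).

Definition word_ract w k : freeW F :=
  let: (p, s, wn) := k in ut2_lift (fun b => word F (p, s, b)) (e wn * w).

Definition freeW_mul f g : freeW F :=
  freeW_lift (fun k => freeW_lift (word_mul k) g) f.

Definition freeW_lact w f : freeW F := freeW_lift (word_lact w) f.

Definition freeW_ract f w : freeW F := freeW_lift (word_ract w) f.

Lemma freeW_liftw (V : lmodType F) (phi : wword -> V) f (d : {fset wword}) :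
  (msupp f `<=` d)%fset -> freeW_lift phi f = \sum_(k <- d) f@_k *: phi k.
Proof.
move=> fd; rewrite /freeW_lift (big_fset_incl _ fd) // => k _.
by move/mcoeff_outdom => ->; rewrite scale0r.
Qed.

Lemma freeW_lift_linear (V : lmodType F) (phi : wword -> V) :
  linear (freeW_lift phi).
Proof.
move=> c f g; pose d := (msupp f `|` msupp g)%fset.
rewrite (@freeW_liftw _ _ (c *: f + g) d).
  rewrite (@freeW_liftw _ _ f d) ?fsubsetUl // (@freeW_liftw _ _ g d) ?fsubsetUr //.
  rewrite scaler_sumr -big_split /=; apply: eq_bigr => k _.
  by rewrite mcoeffD mcoeffZ scalerDl scalerA.
apply: fsubset_trans (msuppD_le _ _) _; apply: fsetSU; exact: msuppZ_le.
Qed.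

Lemma freeW_lift_word (V : lmodType F) (phi : wword -> V) k :
  freeW_lift phi (word F k) = phi k.
Proof.
by rewrite (freeW_liftw _ msuppU_le) big_seq_fset1 mcoeffUU scale1r.
Qed.

Lemma freeW_liftD (V : lmodType F) (phi psi : wword -> V) (c : F) f :
  freeW_lift (fun k => c *: phi k + psi k) f
    = c *: freeW_lift phi f + freeW_lift psi f.
Proof.
rewrite /freeW_lift scaler_sumr -big_split /=; apply: eq_bigr => k _.
by rewrite scalerDr !scalerA mulrC.
Qed.

Lemma eq_freeW_lift (V : lmodType F) (phi psi : wword -> V) :
  phi =1 psi -> freeW_lift phi =1 freeW_lift psi.
Proof. by move=> eq_phi f; apply: eq_bigr => k _; rewrite eq_phi. Qed.

HB.instance Definition _ (V : lmodType F) (phi : wword -> V) :=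
  GRing.isLinear.Build F (freeW F) V _ (freeW_lift phi) (freeW_lift_linear phi).

Lemma freeW_ext (V : lmodType F) (f1 f2 : freeW F -> V) :
  linear f1 -> linear f2 -> (forall k, f1 (word F k) = f2 (word F k)) ->
  f1 =1 f2.
Proof.
move=> lin1 lin2 eq12 f.
suff lift (f0 : freeW F -> V) : linear f0 ->
    f0 f = freeW_lift (fun k => f0 (word F k)) f.
  by rewrite (lift f1) // (lift f2) //; apply: eq_freeW_lift.
move=> lin0; pose L := GRing.isLinear.Build F (freeW F) V _ f0 lin0.
pose f0' : {linear freeW F -> V} := HB.pack f0 L.
rewrite -[f0 f]/(f0' f) {1}[f]monalgE raddf_sum; apply: eq_bigr => k _ /=.
have -> : << f@_k *g k >> = f@_k *: word F k :> freeW F.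
  by apply/malgP => l; rewrite mcoeffZ !mcoeffU mulrnAr mulr1.
by rewrite -[LHS]/(f0' _) linearZ_LR.
Qed.

Lemma ut2_coord_basis (b c : 'I_3) : ut2_coord b (e c) = (b == c)%:R :> F.
Proof.
case: b c => [[|[|[|b]]] // ltb] [[|[|[|c]]] // ltc];
  rewrite /ut2_coord /ut2_basis /= ?mxE ?subrr ?subr0 //.
Qed.

Lemma ut2_lift_linear (V : lmodType F) (G : 'I_3 -> V) : linear (ut2_lift G).
Proof.
move=> c u v; rewrite /ut2_lift scaler_sumr -big_split /=.
by apply: eq_bigr => b _; rewrite ut2_coordP scalerDl scalerA.
Qed.

HB.instance Definition _ (V : lmodType F) (G : 'I_3 -> V) :=
  GRing.isLinear.Build F (UT2 F) V _ (ut2_lift G) (ut2_lift_linear G).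

Lemma ut2_lift_basis (V : lmodType F) (G : 'I_3 -> V) b : ut2_lift G (e b) = G b.
Proof.
rewrite /ut2_lift (bigD1 b) //= ut2_coord_basis eqxx scale1r big1 ?addr0 //.
by move=> c neqcb; rewrite ut2_coord_basis (negPf neqcb) scale0r.
Qed.

Lemma ut2_lift_mull (V : lmodType F) (G : 'I_3 -> V) u w :
  ut2_lift (fun b => ut2_lift G (u * e b)) w = ut2_lift G (u * w).
Proof.
rewrite [in RHS](ut2_coordE w) mulr_sumr raddf_sum; apply: eq_bigr => b _ /=.
by rewrite -scalerAr linearZ_LR.
Qed.

Lemma ut2_lift_mulr (V : lmodType F) (G : 'I_3 -> V) u w :
  ut2_lift (fun b => ut2_lift G (e b * u)) w = ut2_lift G (w * u).
Proof.
rewrite [in RHS](ut2_coordE w) mulr_suml raddf_sum; apply: eq_bigr => b _ /=.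
by rewrite -scalerAl linearZ_LR.
Qed.

Lemma ut2_liftC (V : lmodType F) (H : 'I_3 -> 'I_3 -> V) u w :
  ut2_lift (fun b => ut2_lift (H b) u) w
    = ut2_lift (fun c => ut2_lift (H^~ c) w) u.
Proof.
rewrite /ut2_lift; under eq_bigr do rewrite scaler_sumr.
rewrite exchange_big /=; apply: eq_bigr => c _; rewrite scaler_sumr.
by apply: eq_bigr => b _; rewrite !scalerA mulrC.
Qed.

Lemma eq_ut2_lift (V : lmodType F) (G H : 'I_3 -> V) :
  G =1 H -> ut2_lift G =1 ut2_lift H.
Proof. by move=> eqGH w; apply: eq_bigr => b _; rewrite eqGH. Qed.

Fact freeW_mul_linearl g : linear (freeW_mul^~ g).
Proof. exact: freeW_lift_linear. Qed.

Fact freeW_mul_linearr f : linear (freeW_mul f).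
Proof.
move=> c g h; rewrite /freeW_mul -freeW_liftD.
by apply: eq_freeW_lift => k; rewrite linearP.
Qed.

Fact freeW_lact_linearr w : linear (freeW_lact w).
Proof. exact: freeW_lift_linear. Qed.

Fact freeW_lact_linearl f : linear (freeW_lact^~ f).
Proof.
move=> c u v; rewrite /freeW_lact -freeW_liftD; apply: eq_freeW_lift.
by move=> [[[w0 j] s] wn]; rewrite /word_lact mulrDl -scalerAl linearP.
Qed.

Fact freeW_ract_linearl w : linear (freeW_ract^~ w).
Proof. exact: freeW_lift_linear. Qed.

Fact freeW_ract_linearr f : linear (freeW_ract f).
Proof.
move=> c u v; rewrite /freeW_ract -freeW_liftD; apply: eq_freeW_lift.
by move=> [[p s] wn]; rewrite /word_ract mulrDr -scalerAr linearP.
Qed.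

Let lin := (freeW_mul_linearl, freeW_mul_linearr, freeW_lact_linearl,
  freeW_lact_linearr, freeW_ract_linearl, freeW_ract_linearr).

Let mulE k l : freeW_mul (word F k) (word F l) = word_mul k l.
Proof. by rewrite /freeW_mul !freeW_lift_word. Qed.

Let lactE w k : freeW_lact w (word F k) = word_lact w k.
Proof. exact: freeW_lift_word. Qed.

Let ractE w k : freeW_ract (word F k) w = word_ract w k.
Proof. exact: freeW_lift_word. Qed.

Let lin_ut2 (V : lmodType F) (f0 : freeW F -> V) (G : 'I_3 -> freeW F) w :
  linear f0 -> f0 (ut2_lift G w) = ut2_lift (fun b => f0 (G b)) w.
Proof.
move=> lin0; pose L := GRing.isLinear.Build F (freeW F) V _ f0 lin0.
pose f0' : {linear freeW F -> V} := HB.pack f0 L.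
rewrite -[f0 _]/(f0' _) raddf_sum; apply: eq_bigr => b _.
by rewrite -[LHS]/(f0' _) linearZ_LR.
Qed.

Let lact_lift w (G : 'I_3 -> wword) u :
  freeW_lact w (ut2_lift (fun b => word F (G b)) u)
    = ut2_lift (fun b => word_lact w (G b)) u.
Proof.
rewrite lin_ut2; last exact: freeW_lact_linearr.
by apply: eq_ut2_lift => b; rewrite lactE.
Qed.

Let ract_lift w (G : 'I_3 -> wword) u :
  freeW_ract (ut2_lift (fun b => word F (G b)) u) w
    = ut2_lift (fun b => word_ract w (G b)) u.
Proof.
rewrite (lin_ut2 _ _ (freeW_ract_linearl w)).
by apply: eq_ut2_lift => b; rewrite ractE.
Qed.

Let mul_liftl l (G : 'I_3 -> wword) u :
  freeW_mul (ut2_lift (fun b => word F (G b)) u) (word F l)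
    = ut2_lift (fun b => word_mul (G b) l) u.
Proof.
rewrite (lin_ut2 _ _ (freeW_mul_linearl (word F l))).
by apply: eq_ut2_lift => b; rewrite mulE.
Qed.

Let mul_liftr k (G : 'I_3 -> wword) u :
  freeW_mul (word F k) (ut2_lift (fun b => word F (G b)) u)
    = ut2_lift (fun b => word_mul k (G b)) u.
Proof.
rewrite lin_ut2; last exact: freeW_mul_linearr.
by apply: eq_ut2_lift => b; rewrite mulE.
Qed.

Fact freeW_lact1 f : freeW_lact 1 f = f.
Proof.
apply: (freeW_ext (f1 := freeW_lact 1) (f2 := id)) => [||k] //.
  exact: freeW_lact_linearr.
by case: k => [[[w0 j] s] wn]; rewrite lactE /word_lact mul1r ut2_lift_basis.
Qed.

Fact freeW_ract1 f : freeW_ract f 1 = f.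
Proof.
apply: (freeW_ext (f1 := freeW_ract^~ 1) (f2 := id)) => [||k] //.
  exact: freeW_ract_linearl.
by case: k => [[p s] wn]; rewrite ractE /word_ract mulr1 ut2_lift_basis.
Qed.

Fact freeW_lactA u v f : freeW_lact (u * v) f = freeW_lact u (freeW_lact v f).
Proof.
apply: (freeW_ext (f1 := freeW_lact (u * v))
  (f2 := fun f => freeW_lact u (freeW_lact v f))) => [|c g h|k].
- exact: freeW_lact_linearr.
- by rewrite !freeW_lact_linearr.
case: k => [[[w0 j] s] wn]; rewrite !lactE /word_lact lact_lift.
by rewrite ut2_lift_mull mulrA.
Qed.

Fact freeW_ractA f u v : freeW_ract f (u * v) = freeW_ract (freeW_ract f u) v.
Proof.
apply: (freeW_ext (f1 := freeW_ract^~ (u * v))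
  (f2 := fun f => freeW_ract (freeW_ract f u) v)) => [|c g h|k].
- exact: freeW_ract_linearl.
- by rewrite !freeW_ract_linearl.
case: k => [[p s] wn]; rewrite !ractE /word_ract ract_lift.
by rewrite ut2_lift_mulr mulrA.
Qed.

Fact freeW_lractA u f v :
  freeW_ract (freeW_lact u f) v = freeW_lact u (freeW_ract f v).
Proof.
apply: (freeW_ext (f1 := fun f => freeW_ract (freeW_lact u f) v)
  (f2 := fun f => freeW_lact u (freeW_ract f v))) => [c g h|c g h|k].
- by rewrite freeW_lact_linearr freeW_ract_linearl.
- by rewrite freeW_ract_linearl freeW_lact_linearr.
case: k => [[[w0 j] s] wn].
rewrite lactE ractE /word_lact /word_ract lact_lift ract_lift.
exact: ut2_liftC.
Qed.

Let freeW_ext2 (f1 f2 : freeW F -> freeW F -> freeW F) :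
  (forall g, linear (f1^~ g)) -> (forall f, linear (f1 f)) ->
  (forall g, linear (f2^~ g)) -> (forall f, linear (f2 f)) ->
  (forall k l, f1 (word F k) (word F l) = f2 (word F k) (word F l)) ->
  f1 =2 f2.
Proof.
move=> l1 r1 l2 r2 eq12 f g.
apply: (freeW_ext (f1 := f1^~ g) (f2 := f2^~ g)) => // k.
exact: (freeW_ext (r1 _) (r2 _)).
Qed.

Fact freeW_lact_mul w f g :
  freeW_lact w (freeW_mul f g) = freeW_mul (freeW_lact w f) g.
Proof.
apply: (freeW_ext2 (f1 := fun f g => freeW_lact w (freeW_mul f g))
  (f2 := fun f g => freeW_mul (freeW_lact w f) g)) => [?|?|?|?|k l];
  try by move=> ? ? ?; rewrite !lin.
case: k l => [[[w0 j] s] wn] [[[v0 i] t] vm].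
rewrite mulE lactE /word_mul /word_lact lact_lift mul_liftl.
exact: ut2_liftC.
Qed.

Fact freeW_ract_mul f g w :
  freeW_ract (freeW_mul f g) w = freeW_mul f (freeW_ract g w).
Proof.
apply: (freeW_ext2 (f1 := fun f g => freeW_ract (freeW_mul f g) w)
  (f2 := fun f g => freeW_mul f (freeW_ract g w))) => [?|?|?|?|k l];
  try by move=> ? ? ?; rewrite !lin.
case: k l => [[p s] wn] [[[v0 i] t] vm].
rewrite mulE ractE /word_mul /word_ract ract_lift mul_liftr.
exact: ut2_liftC.
Qed.

Fact freeW_act_mid f w g :
  freeW_mul (freeW_ract f w) g = freeW_mul f (freeW_lact w g).
Proof.
apply: (freeW_ext2 (f1 := fun f g => freeW_mul (freeW_ract f w) g)
  (f2 := fun f g => freeW_mul f (freeW_lact w g))) => [?|?|?|?|k l];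
  try by move=> ? ? ?; rewrite !lin.
case: k l => [[p s] wn] [[[v0 i] t] vm].
rewrite lactE ractE /word_lact /word_ract mul_liftl mul_liftr.
by rewrite ut2_lift_mulr ut2_lift_mull mulrA.
Qed.

Fact freeW_mulA : associative freeW_mul.
Proof.
move=> f g h.
apply: (freeW_ext (f1 := fun h => freeW_mul f (freeW_mul g h))
  (f2 := freeW_mul (freeW_mul f g))) => [c ? ?|c ? ?|m].
- by rewrite !lin.
- by rewrite !lin.
apply: (freeW_ext2 (f1 := fun f g => freeW_mul f (freeW_mul g (word F m)))
  (f2 := fun f g => freeW_mul (freeW_mul f g) (word F m))) => [?|?|?|?|k l];
  try by move=> ? ? ?; rewrite !lin.
case: k l m => [[p s] wn] [[[v0 i] t] vm] [[[u0 j] r] um].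
rewrite !mulE /word_mul mul_liftl mul_liftr.
apply: etrans (ut2_liftC _ _ _) _.
by do 2![apply: eq_ut2_lift => ?]; rewrite -catA.
Qed.

HB.instance Definition _ := Lmodule_isWAlgebra.Build F (freeW F)
  freeW_mul_linearl freeW_mul_linearr freeW_lact_linearl freeW_lact_linearr
  freeW_ract_linearl freeW_ract_linearr freeW_mulA freeW_lact1 freeW_ract1
  freeW_lactA freeW_ractA freeW_lractA freeW_lact_mul freeW_ract_mul
  freeW_act_mid.

End FreeW.

(* [w_1 a_1 w_2 a_2 ... w_n a_n w] for s = [:: (w_1, a_1); ...; (w_n, a_n)];    *)
(* the empty product has no meaning in a W-algebra and is set to 0.             *)
Definition wmonomial (F : fieldType) (A : walgType F) (s : seq (UT2 F * A))
    (w : UT2 F) : A :=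
  if s is p :: s' then
    wract (foldl (fun a q => wmul a (wlact q.1 q.2)) (wlact p.1 p.2) s') w
  else 0.

Definition weval (F : fieldType) (A : walgType F) (a : nat -> A)
    (f : freeW F) : A :=
  freeW_lift (fun k : wword => let: (p, s, wn) := k in
    wmonomial [seq (ut2_basis F q.1, a q.2) | q <- p :: s] (ut2_basis F wn)) f.

Definition GId (F : fieldType) (A : walgType F) (f : freeW F) : Prop :=
  forall a : nat -> A, weval a f = 0.

(* The variable [x_(i+1)], i.e. the word [1 x_(i+1) 1]. *)
Definition wvar (F : fieldType) (i : nat) : freeW F :=
  word F ((ord0, i), [::], ord0).

Definition GP (F : fieldType) (n : nat) (f : freeW F) : Prop :=
  exists (m : nat) (c : 'I_m -> F) (s : 'I_m -> 'S_n)
         (w : 'I_m -> nat -> UT2 F),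
    f = \sum_(i < m) c i *:
          wmonomial [seq (w i k, wvar F (s i k)) | k : 'I_n] (w i n).

(* Renaming of the variables, as the substitution [x_i := x_(s i)]. *)
Definition wrename (F : fieldType) (n : nat) (s : 'S_n) : freeW F -> freeW F :=
  weval (fun i => wvar F (if insub i is Some j then s j else i)).

(* [rG] is a matrix form of the S_n-module GP_n(A) = GP_n / (GP_n \cap GId(A)): *)
(* the classes of e_1, ..., e_d form a basis of the quotient, on which s acts   *)
(* by the rows of [rG s]. The product of permutations being [(s * t) i =        *)
(* t (s i)], left modules for the composition of permutations are right modules *)
(* for the product of ['S_n], as required by [mx_representation].               *)
Definition affords_GP (F : fieldType) (A : walgType F) (n d : nat)
    (rG : mx_representation F [set: 'S_n] d) : Prop :=
  exists e : 'I_d -> freeW F,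
    [/\ forall i, GP n (e i),
        forall f, GP n f -> exists c : 'I_d -> F,
          GId A (f - \sum_i c i *: e i),
        forall c : 'I_d -> F, GId A (\sum_i c i *: e i) -> forall i, c i = 0
      & forall (s : 'S_n) i,
          GId A (wrename s (e i) - \sum_j rG s i j *: e j)].

Definition is_gcocharacter (F : fieldType) (A : walgType F) (n : nat)
    (chi : 'S_n -> F) : Prop :=
  exists (d : nat) (rG : mx_representation F [set: 'S_n] d),
    affords_GP A rG /\ forall s, chi s = \tr (rG s).

Definition is_intpart (n : nat) (la : seq nat) : bool :=
  [&& sorted geq la, all (leq 1) la & sumn la == n].

Record intpart (n : nat) :=
  IntPart { parts :> seq nat; _ : is_intpart n parts }.

HB.instance Definition _ n := [isSub for @parts n].
HB.instance Definition _ n := [Countable of intpart n by <:].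

(* A partition of n has at most n parts, each at most n. *)
Section IntPartFinite.
Variable n : nat.

Let code (la : intpart n) : n.-bseq 'I_n.+1 :=
  insub_bseq n [seq inord i | i <- la].

Let decode (s : n.-bseq 'I_n.+1) : option (intpart n) :=
  insub [seq val i | i <- s].

Fact intpart_codeK : pcancel code decode.
Proof.
case=> la la_part; have /and3P[_ /allP la_gt0 /eqP la_sum] := la_part.
have le_size : (size la <= n)%N.
  rewrite -la_sum; elim: (la) la_gt0 => //= i l IHl il_gt0.
  rewrite -add1n leq_add ?il_gt0 ?mem_head // IHl // => j jl.
  by rewrite il_gt0 // inE jl orbT.
have le_part i : i \in la -> (i <= n)%N.
  rewrite -la_sum; elim: (la) => //= j l IHl.
  rewrite inE => /predU1P[->|/IHl]; first exact: leq_addr.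
  by move/leq_trans; apply; apply: leq_addl.
rewrite /decode (_ : [seq val i | i <- _] = la).
  by rewrite (insubT (is_intpart n) la_part); congr Some; apply: val_inj.
rewrite /code /insub_bseq insubdK ?inE ?unfold_in /= ?size_map //.
rewrite -map_comp -[RHS]map_id; apply/eq_in_map => i /le_part le_in /=.
by rewrite inordK.
Qed.

HB.instance Definition _ := isFinite.Build (intpart n) (pcan_enumP intpart_codeK).
End IntPartFinite.

(* The tableau T of shape la whose cells are numbered row by row: number i is   *)
(* in row [reshape_index la i] and column [reshape_offset la i].                *)
Definition row_stab (n : nat) (la : intpart n) : {set 'S_n} :=
  [set p : 'S_n | [forall i, reshape_index la (p i) == reshape_index la i]].

Definition col_stab (n : nat) (la : intpart n) : {set 'S_n} :=
  [set q : 'S_n | [forall i, reshape_offset la (q i) == reshape_offset la i]].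

(* The Young symmetrizer \sum_(p, q) sgn(q) p q of T, as a row of coordinates   *)
(* in the group algebra F S_n; the composite p \o q is written [q * p] in 'S_n. *)
Definition young_symmetrizer (F : fieldType) (n : nat) (la : intpart n) :
    'rV[F]_#|[set: 'S_n]| :=
  \sum_(p in row_stab la) \sum_(q in col_stab la)
    (-1) ^+ q *: gring_row (regular_repr F [set: 'S_n]%G (q * p)%g).

(* The character of the minimal left ideal generated by the Young symmetrizer,  *)
(* which is a right ideal for the product of ['S_n].                            *)
Definition irr_char (F : fieldType) (n : nat) (la : intpart n) (s : 'S_n) : F :=
  \tr (submod_repr (cyclic_mx_module (regular_repr F [set: 'S_n]%G)
                      (young_symmetrizer F la)) s).

(* Main.v *)
Require Import Defs.
From HB Require Import structures.
From mathcomp Require Import all_boot all_order all_algebra all_fingroup.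
From mathcomp Require Import mxrepresentation finmap monalg zify ring.

(* Evaluating on generic upper triangular matrices with entries a_i = x_i(1,1),  *)
(* b_i = x_i(2,2), c_i = x_i(1,2) shows that GP_n modulo identities is a         *)
(* permutation module: it has the basis (prod_i a_i) e_11, (prod_i b_i) e_22     *)
(* and the e_12-multiples of the products over i of one letter a_i, b_i or c_i,  *)
(* with at most one letter c. With h(a,b,e) the permutation character on words   *)
(* with a, b, e letters of each kind, the cocharacter is therefore               *)
(* 2 h(n,0,0) + sum_k h(k,n-k,0) + sum_k h(k,n-1-k,1).                           *)
(* By the Jacobi-Trudi formula, chi_(a,b) and chi_(a,b,1) should be small        *)
(* integral combinations X of these h. Indeed X has norm 1, by a count of 3 x 3  *)
(* contingency tables, and the inner product of X with the character of the      *)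
(* Young symmetrizer module is 1, since column antisymmetrization kills all      *)
(* terms but the leading one; all values being rational, X - chi has norm 0 and  *)
(* vanishes. A telescoping sum then yields the multiplicities, which are unique  *)
(* because the chi_la are orthogonal.                                            *)

Set Implicit Arguments.
Unset Strict Implicit.
Unset Printing Implicit Defensive.

Import Order.TTheory GRing.Theory Num.Theory.
Local Open Scope ring_scope.

(** * The integral group algebra of a finite group *)

(** The cocharacter is computed as a permutation character and then matched with characters of Young
    symmetrizer modules; on the symmetric group side the arithmetic is integral.

    On the algebra side, multilinearity ([GP_expand]) reduces evaluation on arbitrary matrices to
    evaluation on matrix units. The diagonal entries are multiplicative and a product with two
    strictly upper factors vanishes, so only the functions indexed by [gp_index] survive; chains of
    matrix units realize all of them ([gp_basis]). Renaming variables permutes these functions,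
    whence [affords_gp_perm] and the fixed point count [card_gp_fixed].

    On the symmetric group side, [csum_rsum] makes the Young symmetrizer a multiple of an
    idempotent, and [irr_charE] reads its character off the conjugates of the symmetrizer. A virtual
    character X equals it as soon as X has norm 1 and pairs to 1 with it ([conj_sum_young_virtual]).
    Norms of combinations of permutation characters count contingency tables ([sum_nfixM]); the
    pairing is killed by column antisymmetry except on the leading term ([young_pair0],
    [young_pair1]). This identifies the characters of two-row shapes and of shapes (a, b, 1).

    Finally [sum_hfix_decomposition] telescopes the permutation characters into these virtual
    characters, with Pieri's rule accounting for the single letter of the third kind, and
    [irr_char_free] shows that the coefficients are determined. *)

Definition galg (gT : finGroupType) : Type := {ffun gT -> int}.
HB.instance Definition _ (gT : finGroupType) := GRing.Zmodule.on (galg gT).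

Section GroupAlgebra.
Variable gT : finGroupType.
Implicit Types (f g h : galg gT) (x y z : gT).

Definition gel x : galg gT := [ffun y => (y == x)%:R].

Definition galg_mul f g : galg gT := [ffun x => \sum_y f y * g (y^-1 * x)%g].

Fact galg_mulA : associative galg_mul.
Proof.
move=> f g h; apply/ffunP => x; rewrite !ffunE.
under eq_bigr do rewrite ffunE mulr_sumr.
under [RHS]eq_bigr do rewrite ffunE mulr_suml.
rewrite [RHS]exchange_big /=; apply: eq_bigr => y _.
rewrite [RHS](reindex_inj (mulgI y)) /=; apply: eq_bigr => z _.
by rewrite mulKg invMg mulgA mulrA.
Qed.

Fact galg_mul1 : left_id (gel 1) galg_mul.
Proof.
move=> f; apply/ffunP => x; rewrite ffunE (bigD1 1%g) //= ffunE eqxx invg1 !mul1g.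
by rewrite mul1r big1 ?addr0 // => y /negPf n1; rewrite ffunE n1 mul0r.
Qed.

Fact galg_mulr1 : right_id (gel 1) galg_mul.
Proof.
move=> f; apply/ffunP => x; rewrite ffunE (bigD1 x) //= ffunE mulVg eqxx.
rewrite mulr1 big1 ?addr0 // => y nyx.
by rewrite ffunE -eq_mulVg1 (negPf nyx) mulr0.
Qed.

Fact galg_mulDl : left_distributive galg_mul +%R.
Proof.
move=> f g h; apply/ffunP => x; rewrite !ffunE -big_split /=.
by apply: eq_bigr => y _; rewrite ffunE mulrDl.
Qed.

Fact galg_mulDr : right_distributive galg_mul +%R.
Proof.
move=> f g h; apply/ffunP => x; rewrite !ffunE -big_split /=.
by apply: eq_bigr => y _; rewrite ffunE mulrDr.
Qed.

Fact gel1_neq0 : gel 1 != 0.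
Proof. by apply/eqP => /ffunP/(_ 1%g); rewrite !ffunE eqxx. Qed.

HB.instance Definition _ := GRing.Zmodule_isNzRing.Build (galg gT)
  galg_mulA galg_mul1 galg_mulr1 galg_mulDl galg_mulDr gel1_neq0.

Lemma galgM f g x : (f * g) x = \sum_y f y * g (y^-1 * x)%g.
Proof. by rewrite ffunE. Qed.

Lemma galgD f g x : (f + g) x = f x + g x. Proof. by rewrite ffunE. Qed.

Lemma galg0 x : (0 : galg gT) x = 0. Proof. by rewrite ffunE. Qed.

Lemma galg_sum (I : finType) (P : pred I) (F : I -> galg gT) x :
  (\sum_(i | P i) F i) x = \sum_(i | P i) F i x.
Proof. by rewrite sum_ffunE. Qed.

Lemma galgMz f (c : int) x : (f *~ c) x = c * f x.
Proof.
rewrite -[c in RHS]intz mulrzl.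
by case: c => k; rewrite ?NegzE ?mulrNz ?ffunE -!pmulrn ffunMnE.
Qed.

Lemma gelE x y : gel x y = (y == x)%:R. Proof. by rewrite ffunE. Qed.

Lemma gelM x f y : (gel x * f) y = f (x^-1 * y)%g.
Proof.
rewrite galgM (bigD1 x) //= gelE eqxx mul1r big1 ?addr0 // => z /negPf nzx.
by rewrite gelE nzx mul0r.
Qed.

Lemma Mgel f x y : (f * gel x) y = f (y * x^-1)%g.
Proof.
rewrite galgM (bigD1 (y * x^-1)%g) //= gelE invMg invgK mulgKV eqxx mulr1.
rewrite big1 ?addr0 // => z nz; rewrite gelE (can2_eq (mulKVg z) (mulKg z)).
by rewrite eq_sym (can2_eq (mulgK x) (mulgKV x)) (negPf nz) mulr0.
Qed.

Lemma mul_gel x y : gel x * gel y = gel (x * y).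
Proof.
by apply/ffunP => z; rewrite gelM !gelE (can2_eq (mulKVg x) (mulKg x)).
Qed.

Lemma gel1 : gel 1 = 1 :> galg gT. Proof. by []. Qed.

Lemma galgE f : f = \sum_x gel x *~ f x.
Proof.
apply/ffunP => y; rewrite galg_sum (bigD1 y) //= galgMz gelE eqxx mulr1.
by rewrite big1 ?addr0 // => x /negPf n; rewrite galgMz gelE eq_sym n mulr0.
Qed.

(* The trace form, i.e. the trace of the regular representation over #|gT|. *)
Definition gtr f : int := f 1%g.

Lemma gtrMz f (c : int) : gtr (f *~ c) = c * gtr f. Proof. exact: galgMz. Qed.

Lemma gtrC f g : gtr (f * g) = gtr (g * f).
Proof.
rewrite /gtr !galgM (reindex_inj invg_inj) /=; apply: eq_bigr => y _.
by rewrite invgK !mulg1 mulrC.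
Qed.

Lemma gtr_gel f x : gtr (f * gel x^-1) = f x.
Proof. by rewrite /gtr Mgel invgK mul1g. Qed.

(** The adjunction for the positive definite form of [gtr_starM]; positivity arguments about Young
    symmetrizers rest on it. *)
Definition galg_star f : galg gT := [ffun x => f x^-1%g].

Lemma galg_starM f g : galg_star (f * g) = galg_star g * galg_star f.
Proof.
apply/ffunP => x; rewrite ffunE !galgM (reindex_inj (mulgI x^-1%g)) /=.
apply: eq_bigr => y _; rewrite !ffunE mulrC; congr (_ * f _)%R; last by rewrite invMg invgK.
by rewrite invMg invgK mulgK.
Qed.

Lemma gtr_starM f g : gtr (galg_star f * g) = \sum_x f x * g x.
Proof.
rewrite /gtr galgM (reindex_inj invg_inj) /=; apply: eq_bigr => y _.
by rewrite ffunE invgK mulg1.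
Qed.

(** A class function; when a nonzero multiple of f is idempotent, it is proportional to the
    character of the module generated by f. *)
Definition conj_sum f x : int := \sum_y f (y * x * y^-1)%g.

(** Up to the order of the group, the inner product of the class functions attached to f and g
    ([conj_sum_pair]), in a form that products in the group algebra can evaluate. *)
Definition conj_form f g : int := \sum_y gtr (f * gel y * g * gel y^-1).

Lemma conj_formC f g : conj_form f g = conj_form g f.
Proof.
rewrite /conj_form (reindex_inj invg_inj) /=; apply: eq_bigr => y _.
by rewrite invgK -mulrA gtrC !mulrA.
Qed.

Lemma conj_formDr f : {morph conj_form f : g h / g + h}.
Proof.
move=> g h; rewrite -big_split /=; apply: eq_bigr => y _.
by rewrite mulrDr mulrDl /gtr galgD.
Qed.

Lemma conj_form0r f : conj_form f 0 = 0.
Proof. by apply: big1 => y _; rewrite mulr0 mul0r /gtr galg0. Qed.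

Lemma conj_form_sumr f (I : finType) (P : pred I) (G : I -> galg gT) :
  conj_form f (\sum_(i | P i) G i) = \sum_(i | P i) conj_form f (G i).
Proof. exact: (big_morph _ (conj_formDr f) (conj_form0r f)). Qed.

Lemma conj_formMzr f g c : conj_form f (g *~ c) = c * conj_form f g.
Proof.
rewrite /conj_form mulr_sumr; apply: eq_bigr => y _.
by rewrite mulrzAr mulrzAl gtrMz.
Qed.

Lemma conj_form_gel f x : conj_form f (gel x^-1) = conj_sum f x.
Proof.
apply: eq_bigr => y _; rewrite -!mulrA !mul_gel -[RHS]gtr_gel.
by rewrite !invMg invgK mulgA.
Qed.

Lemma conj_formJ f g x : conj_form f (gel x * g * gel x^-1) = conj_form f g.
Proof.
rewrite /conj_form (reindex_inj (mulIg x^-1%g)) /=; apply: eq_bigr => y _.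
by rewrite -!mul_gel invMg invgK -!mul_gel !mulrA -4!mulrA !(mulrA (gel x^-1)) mul_gel
  mulVg gel1 !mul1r -!mulrA !(mulrA (gel x^-1)) mul_gel mulVg gel1 mul1r.
Qed.

(** The values of [conj_sum g] are the coefficients of the sum of all conjugates of g, and
    [conj_form f] takes the same value on each conjugate. *)
Lemma conj_sum_pair f g :
  \sum_x conj_sum f x * conj_sum g x^-1 = #|gT|%:Z * conj_form f g.
Proof.
transitivity (conj_form f (\sum_y gel y^-1 * g * gel y)).
  rewrite -[LHS]/(\sum_x _) (eq_bigr (fun x =>
      conj_form f (gel x^-1 *~ conj_sum g x^-1))); last first.
    by move=> x _; rewrite conj_formMzr conj_form_gel mulrC.
  rewrite -conj_form_sumr; congr (conj_form f _).
  rewrite [RHS]galgE (reindex_inj invg_inj) /=; apply: eq_bigr => x _.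
  rewrite invgK; congr (_ *~ _); rewrite galg_sum /conj_sum; apply: eq_bigr => y _.
  by rewrite Mgel gelM invgK ?mulgA.
rewrite conj_form_sumr (eq_bigr (fun=> conj_form f g)).
  by rewrite sumr_const -mulr_natl natz.
by move=> y _; rewrite -{2}[y]invgK conj_formJ.
Qed.

Lemma conj_class_central g x :
  gel x * (\sum_y gel y * g * gel y^-1) = (\sum_y gel y * g * gel y^-1) * gel x.
Proof.
rewrite mulr_sumr mulr_suml [RHS](reindex_inj (mulgI x)) /=.
apply: eq_bigr => y _; rewrite -mul_gel invMg -mul_gel -!mulrA mul_gel mulVg.
by rewrite gel1 mulr1.
Qed.

Lemma conj_formE f g :
  conj_form f g = gtr (f * \sum_y gel y * g * gel y^-1).
Proof.
rewrite mulr_sumr /gtr galg_sum.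
by apply: eq_bigr => y _; rewrite /gtr !mulrA.
Qed.

(** The sum of the conjugates of h is central, so the trace property applies to f and g. *)
Lemma conj_formM f g h : conj_form (f * g) h = conj_form (g * f) h.
Proof.
rewrite !conj_formE -mulrA gtrC -!mulrA; congr (gtr (_ * _)).
have := conj_class_central h; set Z := \sum_y _ => ZC.
rewrite [f]galgE mulr_sumr mulr_suml; apply: eq_bigr => x _.
by rewrite mulrzAl mulrzAr ZC.
Qed.

Lemma conj_sumM f g x : conj_sum (f * g) x = conj_sum (g * f) x.
Proof. by rewrite -!conj_form_gel conj_formM. Qed.

Lemma conj_sum_star f x : conj_sum (galg_star f) x = conj_sum f x^-1.
Proof.
by apply: eq_bigr => y _; rewrite ffunE !invMg invgK mulgA.
Qed.

End GroupAlgebra.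

(** * Tableaux *)

Local Open Scope nat_scope.

Section Tableau.
Variables (n : nat) (la : intpart n).
Implicit Types x y : 'I_n.

Definition trow x := reshape_index la x.
Definition tcol x := reshape_offset la x.

Lemma intpart_sum : sumn la = n.
Proof. by case: la => l /= /and3P[_ _ /eqP]. Qed.

Lemma intpart_gt0 i : i < size la -> 0 < nth 0 la i.
Proof. by case: la => l /= /and3P[_ /all_nthP p _] lti; apply: p. Qed.

Lemma intpart_nth_anti i j : i <= j -> nth 0 la j <= nth 0 la i.
Proof.
case: la => l /= /and3P[l_sorted _ _] leij.
case: (ltnP j (size l)) => ltj; last by rewrite (nth_default _ ltj).
have geq_trans : transitive geq by move=> y x z /= h1 h2; apply: leq_trans h1.
apply: (sorted_leq_nth geq_trans) => //; first exact: leqnn.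
exact: leq_ltn_trans ltj.
Qed.

Lemma tcol_lt x : tcol x < nth 0 la (trow x).
Proof. by apply: reshape_offsetP; rewrite intpart_sum. Qed.

Lemma tcell r c : c < nth 0 la r -> exists2 x, trow x = r & tcol x = c.
Proof.
move=> ltc; have := flatten_indexP ltc; rewrite intpart_sum => ltn.
exists (Ordinal ltn); first exact: flatten_indexKl.
exact: flatten_indexKr.
Qed.

Lemma trow_col_inj x y : trow x = trow y -> tcol x = tcol y -> x = y.
Proof.
rewrite /trow /tcol => er ec; apply: val_inj => /=.
by rewrite -(reshape_indexK la x) er ec reshape_indexK.
Qed.

Lemma card_trow k : #|[pred x | trow x == k]| = nth 0 la k.
Proof.
have ms : {subset iota 0 (nth 0 la k) <= map tcol (enum [pred x | trow x == k])}.
  move=> c; rewrite mem_iota /= => /tcell[x rx <-].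
  by apply: map_f; rewrite mem_enum inE rx.
have sm : {subset map tcol (enum [pred x | trow x == k]) <= iota 0 (nth 0 la k)}.
  move=> c /mapP[x]; rewrite mem_enum inE => /eqP <- ->.
  by rewrite mem_iota tcol_lt.
have um : uniq (map tcol (enum [pred x | trow x == k])).
  rewrite map_inj_in_uniq ?enum_uniq // => x y.
  rewrite !mem_enum !inE => /eqP rx /eqP ry; apply: trow_col_inj.
  by rewrite rx ry.
apply/eqP; rewrite cardE -(size_map tcol) -(size_iota 0 (nth 0 la k)).
by rewrite eqn_leq !uniq_leq_size ?iota_uniq.
Qed.

(* A column of la holds the rows 0, 1, ... without gaps. *)
Lemma leq_card_column (r : 'I_n -> nat) j k :
  {in [pred x | tcol x == j] &, injective r} ->
  #|[pred x | (tcol x == j) && (r x < k)]| <= #|[pred x | (tcol x == j) && (trow x < k)]|.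
Proof.
move=> r_inj; case: (pickP [pred y | (tcol y == j) && (k <= trow y)]) => [y|no].
  move=> /= /andP[/eqP cy ky]; apply: (@leq_trans k).
    rewrite cardE -(size_map r) -[leqRHS](size_iota 0) uniq_leq_size //.
      rewrite map_inj_in_uniq ?enum_uniq // => x z.
      rewrite !mem_enum !inE => /andP[cx _] /andP[cz _].
      by apply: r_inj; rewrite inE.
    move=> i /mapP[x]; rewrite mem_enum inE mem_iota => /andP[_ ?] ->.
    by rewrite add0n.
  rewrite cardE -(size_map trow) -[leqLHS](size_iota 0) uniq_leq_size ?iota_uniq //.
  move=> i; rewrite mem_iota /= add0n => ltik.
  have ltji : j < nth 0 la i.
    rewrite -cy (leq_trans (tcol_lt y)) // intpart_nth_anti //.
    exact: leq_trans (ltnW ltik) ky.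
  have [x rx cx] := tcell ltji.
  by rewrite -rx; apply: map_f; rewrite mem_enum inE rx cx eqxx.
apply: subset_leq_card; apply/subsetP => x; rewrite !inE => /andP[/eqP cx _].
by have := no x; rewrite /= cx eqxx /= ltnNge => ->.
Qed.

Lemma card_column_sum (r : 'I_n -> nat) k :
  #|[pred x | r x < k]|
    = \sum_(j < n) #|[pred x | (tcol x == j) && (r x < k)]|.
Proof.
rewrite -sum1_card.
have tcol_ltn x : tcol x < n.
  by apply: leq_ltn_trans (ltn_ord x); rewrite /tcol /reshape_offset leq_subr.
rewrite (partition_big (fun x => Ordinal (tcol_ltn x)) xpredT) //=.
by apply: eq_bigr => j _; rewrite -sum1_card; apply: eq_bigl => x; rewrite !inE andbC.
Qed.

End Tableau.

Lemma eq_intpart n (la mu : intpart n) : nth 0 la =1 nth 0 mu -> la = mu.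
Proof.
move=> eq_nth; apply: val_inj => /=.
suff le_size (l m : intpart n) : nth 0 l =1 nth 0 m -> size l <= size m.
  apply: (@eq_from_nth _ 0) => // ; apply/eqP.
  by rewrite eqn_leq !le_size.
move=> e; rewrite leqNgt; apply/negP => lt.
by have := intpart_gt0 lt; rewrite e nth_default.
Qed.

Lemma card_perm_comp n (g : 'S_n) (P : pred 'I_n) :
  #|[pred x | P (g x)]| = #|[pred x | P x]|.
Proof.
rewrite -!sum1_card [RHS](reindex_inj (@perm_inj _ g)) /=.
by apply: eq_bigl.
Qed.

(** When this fails, column antisymmetrization over la and row symmetrization over mu annihilate
    each other across g ([csum_wsum_eq0]). *)
Definition transversal n (la mu : intpart n) (g : 'S_n) : bool :=
  [forall x, forall y, (tcol la x == tcol la y)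
    && (trow mu (g x) == trow mu (g y)) ==> (x == y)].

Lemma transversalP n (la mu : intpart n) (g : 'S_n) :
  reflect
    (forall x y, tcol la x = tcol la y -> trow mu (g x) = trow mu (g y) -> x = y)
    (transversal la mu g).
Proof.
apply: (iffP idP) => [/'forall_'forall_implyP tg x y cxy rxy|tg].
  by apply/eqP; apply: tg; rewrite cxy rxy !eqxx.
apply/'forall_'forall_implyP => x y /andP[/eqP cxy /eqP rxy].
by apply/eqP; apply: tg.
Qed.

Lemma transversalPn n (la mu : intpart n) (g : 'S_n) :
  ~~ transversal la mu g ->
  exists x y, [/\ x != y, tcol la x = tcol la y & trow mu (g x) = trow mu (g y)].
Proof.
rewrite negb_forall => /existsP[x]; rewrite negb_forall => /existsP[y].
by rewrite negb_imply => /andP[/andP[/eqP cxy /eqP rxy] nxy]; exists x, y.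
Qed.

Section Dominance.
Variable n : nat.
Implicit Types (la mu : intpart n) (g : 'S_n).

Lemma transversal_column la mu g j k : transversal la mu g ->
  #|[pred x | (tcol la x == j) && (trow mu (g x) < k)]|
    <= #|[pred x | (tcol la x == j) && (trow la x < k)]|.
Proof.
move=> /transversalP tg; apply: leq_card_column => x y; rewrite !inE => /eqP cx /eqP cy.
by apply: tg; rewrite cx cy.
Qed.

(** This is dominance of la over mu. In each column of la the values of the row of g x are distinct,
    so at most as many lie below k as there are cells of that column in the first k rows. *)
Lemma transversal_dominance la mu g k : transversal la mu g ->
  #|[pred x | trow mu x < k]| <= #|[pred x | trow la x < k]|.
Proof.
move=> tg; rewrite -(card_perm_comp g (fun x => trow mu x < k)).
rewrite (card_column_sum la (fun x => trow mu (g x))) (card_column_sum la (trow la)).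
by apply: leq_sum => j _; apply: transversal_column.
Qed.

Lemma transversal_anti la mu g h :
  transversal la mu g -> transversal mu la h -> la = mu.
Proof.
move=> tg th; have eqk k : #|[pred x | trow la x < k]| = #|[pred x | trow mu x < k]|.
  apply/eqP; rewrite eqn_leq (transversal_dominance _ tg).
  by rewrite (transversal_dominance _ th).
have split_row nu k : #|[pred x | trow nu x < k.+1]|
    = #|[pred x | trow nu x < k]| + nth 0 nu k.
  rewrite -card_trow -cardUI [X in _ + X]eq_card0 => [|x].
    by rewrite addn0; apply: eq_card => x; rewrite !inE ltnS leq_eqVlt orbC.
  by rewrite !inE; case: ltngtP.
apply: eq_intpart => k; apply/eqP.
by rewrite -(eqn_add2l #|[pred x | trow la x < k]|) -split_row eqk split_row eqk.
Qed.

(** Each cell x can be moved within its column to the row that g prescribes; what then remains of g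
    preserves rows. *)
Lemma transversal_col_row la g : transversal la la g ->
  exists q p : 'S_n, [/\ g = (q * p)%g, forall x, tcol la (q x) = tcol la x
    & forall x, trow la (p x) = trow la x].
Proof.
move=> tg0; have /transversalP tg := tg0.
(* Summed over the columns, both counts agree because g is a bijection, so the inequality is an
   equality in every column. *)
have eq_col (j : 'I_n) k : #|[pred x | (tcol la x == j) && (trow la (g x) < k)]|
    = #|[pred x | (tcol la x == j) && (trow la x < k)]|.
  have le (i : 'I_n) : true -> #|[pred x | (tcol la x == i) && (trow la (g x) < k)]|
      <= #|[pred x | (tcol la x == i) && (trow la x < k)]| ?= iff
    (#|[pred x | (tcol la x == i) && (trow la (g x) < k)]|
      == #|[pred x | (tcol la x == i) && (trow la x < k)]|).
    by move=> _; split=> //; apply: transversal_column.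
  have [_] := leqif_sum le; rewrite -(card_column_sum la (fun x => trow la (g x))).
  rewrite -(card_column_sum la (trow la)) (card_perm_comp g (fun x => trow la x < k)) eqxx.
  by move/esym/forallP/(_ j)/eqP.
(* Otherwise the whole column of x would lie above the row of g x, and x would be counted on the
   right of [eq_col] but not on the left. *)
have in_diagram x : tcol la x < nth 0 la (trow la (g x)).
  rewrite ltnNge; apply/negP => out.
  have ltj : tcol la x < n.
    by apply: leq_ltn_trans (ltn_ord x); rewrite /tcol /reshape_offset leq_subr.
  have := eq_col (Ordinal ltj) (trow la (g x)); apply/eqP; rewrite ltn_eqF //=.
  apply: proper_card; apply/properP; split.
    apply/subsetP => y; rewrite !inE => /andP[/eqP cy _]; rewrite cy eqxx /=.
    rewrite ltnNge; apply/negP => le.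
    have := leq_trans (tcol_lt la y) (intpart_nth_anti la le).
    by rewrite cy ltnNge out.
  exists x; rewrite !inE eqxx /= ?ltnn //.
  rewrite ltnNge; apply/negP => le.
  by have := leq_trans (tcol_lt la x) (intpart_nth_anti la le); rewrite ltnNge out.
have [w rw cw] := fin_all_exists2 (fun x => tcell (in_diagram x)).
have w_inj : injective w.
  move=> x y exy; apply: tg; first by rewrite -(cw x) -(cw y) exy.
  by rewrite -(rw x) -(rw y) exy.
exists (perm w_inj), (g^-1 * perm w_inj)^-1%g; split=> [|x|x].
- by rewrite invMg invgK mulKVg.
- by rewrite permE cw.
- set y := (_ x); have -> : x = (g^-1 * perm w_inj)%g y by rewrite permKV.
  by rewrite permM permE rw permKV.
Qed.

End Dominance.

Local Open Scope ring_scope.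

(** * Young symmetrizers *)

Section WordStabilizer.
Variables (n : nat) (T : eqType) (w : 'I_n -> T).
Implicit Types s g : 'S_n.

Definition wstab : {set 'S_n} := [set s : 'S_n | [forall x, w (s x) == w x]].

Definition wsum : galg 'S_n := \sum_(s in wstab) gel s.

Lemma wstabP s : reflect (forall x, w (s x) = w x) (s \in wstab).
Proof. by rewrite inE; apply: (iffP forallP) => h x; apply/eqP. Qed.

Lemma wstab1 : 1%g \in wstab.
Proof. by apply/wstabP => x; rewrite perm1. Qed.

Lemma wstabV s : (s^-1%g \in wstab) = (s \in wstab).
Proof.
suff h t : t \in wstab -> t^-1%g \in wstab.
  by apply/idP/idP => [/h|/h //]; rewrite invgK.
by move/wstabP => wt; apply/wstabP => x; rewrite -wt permKV.
Qed.

Lemma wstabMl s g : s \in wstab -> ((s * g)%g \in wstab) = (g \in wstab).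
Proof.
move/wstabP=> ws; apply/wstabP/wstabP => wg x; last by rewrite permM wg ws.
by rewrite -[x](permKV s) -permM wg -ws permKV.
Qed.

Lemma wsumE s : wsum s = (s \in wstab)%:R.
Proof.
rewrite /wsum galg_sum; case: (boolP (s \in wstab)) => ws.
  rewrite (bigD1 s) //= gelE eqxx big1 ?addr0 // => t /andP[_ /negPf ts].
  by rewrite gelE eq_sym ts.
rewrite big1 // => t wt; rewrite gelE.
by case: eqP ws => // ->; rewrite wt.
Qed.

Lemma gel_wsum s : s \in wstab -> gel s * wsum = wsum.
Proof.
by move=> ws; apply/ffunP => g; rewrite gelM !wsumE wstabMl ?wstabV.
Qed.

Lemma wsum_star : galg_star wsum = wsum.
Proof. by apply/ffunP => s; rewrite ffunE !wsumE wstabV. Qed.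

Lemma wsumM : wsum * wsum = wsum *~ #|wstab|.
Proof.
rewrite {1}/wsum mulr_suml (eq_bigr _ gel_wsum) sumr_const.
by rewrite pmulrn.
Qed.

End WordStabilizer.

Section YoungSymmetrizer.
Variables (n : nat) (la : intpart n).
Implicit Types (s g p q : 'S_n) (x y : 'I_n).

Definition csum : galg 'S_n := \sum_(q in col_stab la) gel q *~ (-1) ^+ q.

Definition rsum : galg 'S_n := wsum (trow la).

(* [rsum] comes second since [s * t] applies s first in ['S_n]. *)
Definition young : galg 'S_n := csum * rsum.

(** The scalar by which the symmetrizer differs from an idempotent, by [youngM]. *)
Definition young_coef : int := gtr (young * young).

Lemma row_stabE : row_stab la = wstab (trow la). Proof. by []. Qed.
Lemma col_stabE : col_stab la = wstab (tcol la). Proof. by []. Qed.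

Lemma csumE s : csum s = (-1) ^+ s * (s \in col_stab la)%:R.
Proof.
rewrite /csum galg_sum; case: (boolP (s \in col_stab la)) => ws.
  rewrite (bigD1 s) //= galgMz gelE eqxx big1 ?addr0 // => t /andP[_ /negPf ts].
  by rewrite galgMz gelE eq_sym ts mulr0.
rewrite mulr0 big1 // => t wt; rewrite galgMz gelE.
by case: eqP ws => [->|]; rewrite ?wt ?mulr0.
Qed.

Lemma csum_star : galg_star csum = csum.
Proof.
by apply/ffunP => s; rewrite ffunE !csumE col_stabE wstabV odd_permV.
Qed.

Lemma gel_csum q : q \in col_stab la -> gel q * csum = csum *~ (-1) ^+ q.
Proof.
move=> cq; apply/ffunP => s; rewrite gelM galgMz !csumE !col_stabE wstabMl ?wstabV //.
by rewrite odd_permM odd_permV signr_addb mulrA.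
Qed.

Lemma csum_gel q : q \in col_stab la -> csum * gel q = csum *~ (-1) ^+ q.
Proof.
move=> cq; rewrite -{1}csum_star.
have -> : gel q = galg_star (gel q^-1).
  by apply/ffunP => x; rewrite !ffunE (inj_eq invg_inj).
rewrite -galg_starM gel_csum ?col_stabE ?wstabV // odd_permV.
by apply/ffunP => x; rewrite ffunE !galgMz -{2}csum_star ffunE.
Qed.

Lemma csumM : csum * csum = csum *~ #|col_stab la|.
Proof.
rewrite {1}/csum mulr_suml (eq_bigr (fun=> csum)).
  by rewrite sumr_const pmulrn.
move=> q cq; rewrite mulrzAl gel_csum // -mulrzA -expr2 sqrr_sign //.
Qed.

(** The transposition of x and y changes the sign of [csum], while its conjugate by g is absorbed by
    [wsum w]; the product is thus its own opposite. *)
Lemma csum_wsum_eq0 (T : eqType) (w : 'I_n -> T) g x y :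
  x != y -> tcol la x = tcol la y -> w (g x) = w (g y) ->
  csum * gel g * wsum w = 0.
Proof.
move=> nxy cxy wxy; set z := _ * wsum w.
suff : z = - z by move/ffunP=> zN; apply/ffunP => s; have := zN s; rewrite !ffunE; lia.
have ct : tperm x y \in col_stab la.
  by rewrite col_stabE; apply/wstabP => u; case: tpermP => [->|->|].
have wt : tperm (g x) (g y) \in wstab w.
  by apply/wstabP => u; case: tpermP => [->|->|].
rewrite {1}/z -(gel_wsum wt) -mulrA (mulrA (gel g)) mul_gel -tpermJ -conjgC -mul_gel.
rewrite -(mulrA (gel _)) (mulrA csum) csum_gel // odd_tperm nxy expr1 mulrzAl.
by rewrite mulrN1z /z mulrA.
Qed.

(** Only the identity preserves both rows and columns. *)
Lemma gtr_young : gtr young = 1.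
Proof.
rewrite /gtr /young galgM (bigD1 1%g) //= csumE col_stabE wstab1 odd_perm1 expr0.
rewrite wsumE mulr1 invg1 mulg1 wstab1 mulr1 big1 ?addr0 // => q nq1.
rewrite csumE wsumE mulg1 wstabV col_stabE -mulrA -natrM mulnb.
case: andP => [[/wstabP cq /wstabP rq]|]; last by rewrite mulr0.
by case/eqP: nq1; apply/permP => x; rewrite perm1; apply: (trow_col_inj (rq x) (cq x)).
Qed.

(* Either g is a product of a column and a row permutation, or it carries two     *)
(* cells of a column into a row, and their transposition yields opposite signs.    *)
Lemma csum_rsum_gel g : csum * gel g * rsum = young *~ gtr (csum * gel g * rsum).
Proof.
have [tg|/transversalPn[x [y [nxy cxy rxy]]]] := boolP (transversal la la g); last first.
  by rewrite (csum_wsum_eq0 nxy cxy rxy) /gtr galg0.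
have [q [p [-> cq rp]]] := transversal_col_row tg.
have {}cq : q \in col_stab la by rewrite col_stabE; apply/wstabP.
have {}rp : p \in wstab (trow la) by apply/wstabP.
rewrite -mul_gel mulrA -(mulrA _ (gel p)) gel_wsum // csum_gel // mulrzAl.
by rewrite -/young gtrMz gtr_young mulr1.
Qed.

Lemma csum_rsum f : csum * f * rsum = young *~ gtr (csum * f * rsum).
Proof.
rewrite [f]galgE [csum * _]mulr_sumr [_ * rsum]mulr_suml /gtr galg_sum mulrz_sumr.
apply: eq_bigr => g _; rewrite mulrzAr mulrzAl galgMz mulrC mulrzA.
by rewrite -csum_rsum_gel.
Qed.

Lemma youngM : young * young = young *~ young_coef.
Proof.
have e : young * young = csum * (rsum * csum) * rsum by rewrite /young !mulrA.
by rewrite /young_coef e; apply: csum_rsum.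
Qed.

Lemma rsumM : rsum * rsum = rsum *~ #|row_stab la|.
Proof. exact: wsumM. Qed.

Lemma rsum_star : galg_star rsum = rsum.
Proof. exact: wsum_star. Qed.

Lemma gtr_rcr f : gtr (rsum * csum * rsum * f) = gtr (csum * (rsum * f * rsum)).
Proof. by rewrite -!mulrA gtrC -!mulrA. Qed.

Lemma young_coef_gt0 : 0 < young_coef.
Proof.
(* sum_g (z g)^2 = r^2 * young_coef for the self-adjoint element z. *)
pose z := rsum * csum * rsum; pose r := #|row_stab la|; pose c := #|col_stab la|.
have zS : galg_star z = z.
  by rewrite /z !galg_starM csum_star rsum_star mulrA.
have zz : \sum_g z g * z g = r%:Z ^+ 2 * young_coef.
  have rz : rsum * z = z *~ r by rewrite /z !mulrA rsumM !mulrzAl.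
  have zr : z * rsum = z *~ r by rewrite /z -mulrA rsumM mulrzAr.
  rewrite -gtr_starM zS gtr_rcr rz mulrzAl zr !mulrzAr !gtrMz expr2 -mulrA.
  by congr (_ * (_ * _)); rewrite /young_coef /z gtrC /young -!mulrA gtrC -!mulrA.
(* A second sum of squares, positive since [young] has coefficient 1 at the identity; it makes
   [gtr z] nonzero, and with it the sum of squares of z positive. *)
have yy : \sum_g young g * young g = c%:Z * gtr z.
  rewrite -gtr_starM /young galg_starM csum_star rsum_star -mulrA.
  by rewrite (mulrA csum) csumM mulrzAl mulrzAr gtrMz mulrA.
have yy_gt0 : 0 < \sum_g young g * young g.
  rewrite (bigD1 1%g) //= -/(gtr young) gtr_young mulr1 ltr_wpDr ?ltr01 //.
  by apply: sumr_ge0 => g _; rewrite -expr2 sqr_ge0.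
have z1 : gtr z != 0 by apply: contraTneq yy_gt0 => z0; rewrite yy z0 mulr0.
have zz_gt0 : 0 < \sum_g z g * z g.
  rewrite (bigD1 1%g) //= -/(gtr z) ltr_wpDr //.
    by apply: sumr_ge0 => g _; rewrite -expr2 sqr_ge0.
  by rewrite -expr2 lt_def sqr_ge0 sqrf_eq0 z1.
rewrite zz in zz_gt0; have r_ge0 : 0 <= r%:Z ^+ 2 by rewrite sqr_ge0.
by have := pmulr_rgt0 young_coef; nia.
Qed.

Lemma conj_sum_youngV s : conj_sum young s^-1 = conj_sum young s.
Proof.
by rewrite -conj_sum_star galg_starM csum_star rsum_star conj_sumM.
Qed.

Lemma gtr_sum_inv (f h : galg 'S_n) : \sum_g gtr (f * gel g) * h g = gtr (f * h).
Proof.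
rewrite /gtr galgM [RHS](reindex_inj invg_inj) /=; apply: eq_bigr => g _.
by rewrite Mgel mul1g mulg1 invgK.
Qed.

(** By [csum_rsum] every young * gel g * young is a multiple of [young], and the multipliers
    recombine into a trace of a product. Dividing by the square of [young_coef] gives norm 1 for the
    character. *)
Lemma conj_form_young : conj_form young young = young_coef ^+ 2.
Proof.
transitivity (\sum_g gtr (young *~ young_coef * gel g) * young g).
  apply: eq_bigr => g _; rewrite -youngM.
  have e : young * gel g * young = csum * (rsum * gel g * csum) * rsum.
    by rewrite /young !mulrA.
  rewrite e csum_rsum -e mulrzAl gtrMz gtr_gel; congr (_ * _).
  by rewrite gtrC mulrA.
by rewrite gtr_sum_inv mulrzAl gtrMz expr2.
Qed.

(** This underlies the fact that the module of la occurs once in the permutation module on the words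
    of content la. *)
Lemma conj_form_young_rsum :
  conj_form young rsum = #|row_stab la|%:Z * young_coef.
Proof.
transitivity (\sum_g gtr (rsum * young * gel g) * young g).
  apply: eq_bigr => g _; rewrite /young -(mulrA csum rsum) csum_rsum mulrzAl gtrMz.
  by rewrite gtr_gel; congr (_ * _); rewrite gtrC !mulrA.
rewrite gtr_sum_inv /young_coef /young gtrC !mulrA -(mulrA _ rsum rsum).
by rewrite rsumM mulrzAr !mulrzAl gtrMz.
Qed.

Lemma conj_form_young_wsum0 (T : eqType) (w : 'I_n -> T) :
  (forall g : 'S_n, exists x y,
    [/\ x != y, tcol la x = tcol la y & w (g x) = w (g y)]) ->
  conj_form young (wsum w) = 0.
Proof.
move=> h; have kill f : csum * f * wsum w = 0.
  rewrite [f]galgE [_ * (\sum_x gel x *~ _)]mulr_sumr [_ * wsum _]mulr_suml big1 // => g _.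
  have [x [y [nxy cxy wxy]]] := h g.
  by rewrite mulrzAr mulrzAl (csum_wsum_eq0 nxy cxy wxy) mul0rz.
by apply: big1 => g _; rewrite /young -(mulrA csum rsum) kill mul0r /gtr galg0.
Qed.

End YoungSymmetrizer.

Lemma csum_rsum_eq0 n (la mu : intpart n) f :
  (forall g, ~~ transversal la mu g) -> csum la * f * rsum mu = 0.
Proof.
move=> h; rewrite [f]galgE [_ * (\sum_x gel x *~ _)]mulr_sumr [_ * rsum _]mulr_suml big1 // => g _.
have [x [y [nxy cxy rxy]]] := transversalPn (h g).
by rewrite mulrzAr mulrzAl (csum_wsum_eq0 nxy cxy rxy) mul0rz.
Qed.

(** Transversals in both directions would force la = mu by [transversal_anti]; in a direction
    without any, all products in the form vanish, and the form is symmetric. *)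
Lemma conj_form_young_neq n (la mu : intpart n) :
  la != mu -> conj_form (young la) (young mu) = 0.
Proof.
suff half (nu ka : intpart n) : (forall g, ~~ transversal nu ka g) ->
    conj_form (young nu) (young ka) = 0.
  move=> neq; have [/existsP[g tg]|] := boolP [exists g, transversal la mu g].
    rewrite conj_formC; apply: half => h; apply: contra neq => th.
    by apply/eqP; apply: transversal_anti tg th.
  by rewrite negb_exists => /forallP; apply: half.
move=> h; apply: big1 => g _.
rewrite /young !mulrA -(mulrA (csum nu) (rsum nu)).
by rewrite -(mulrA (csum nu) (_ * _)) csum_rsum_eq0 // mul0r /gtr galg0.
Qed.

(** * The characters of the Young symmetrizer modules *)

Lemma intr_eq0_char0 (F : fieldType) (z : int) :
  [pchar F] =i pred0 -> (z%:~R == 0 :> F) = (z == 0).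
Proof.
move=> /pcharf0P char0; case: z => k; first exact: char0.
by rewrite NegzE mulrNz oppr_eq0 char0.
Qed.

(** The hypotheses make P a projection onto U, so projecting first and then acting leaves only the
    trace on U. *)
Lemma mxtrace_submod_proj (F : fieldType) (gT : finGroupType) (G : {group gT})
    (N : nat) (rG : mx_representation F G N) (U P : 'M_N)
    (Umod : mxmodule rG U) x :
  x \in G -> (P <= U)%MS -> U *m P = U ->
  \tr (submod_repr Umod x) = \tr (P *m rG x).
Proof.
move=> Gx sPU UP; pose J := in_submod U 1%:M; pose B := @val_submod F N U _ 1%:M.
have onU (W : 'M_N) : (W <= U)%MS -> W *m (J *m B) = W.
  by move=> sWU; rewrite mulmxA -in_submodE -val_submodE in_submodK.
have JBP : (J *m B) *m P = J *m B.
  have /submxP[D ->] : (J *m B <= U)%MS by rewrite -val_submodE val_submodP.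
  by rewrite -mulmxA UP.
rewrite /= /submod_mx in_submodE -/J -/B mxtrace_mulC mulmxA mxtrace_mulC -JBP.
by rewrite mulmxA mxtrace_mulC mulmxA onU // mxmodule_trans.
Qed.

Lemma sum_setT_enum_val (T : finType) (V : nmodType) (f : T -> V) :
  \sum_x f x = \sum_(i < #|[set: T]|) f (enum_val i).
Proof. by rewrite -big_enum_val; apply: eq_bigl => x; rewrite inE. Qed.

Section RegularGalg.
Variables (F : fieldType) (gT : finGroupType).
Local Notation G := [set: gT].
Local Notation rG := (regular_repr F [set: gT]%G).
Implicit Types (f g : galg gT) (x y : gT).

Definition galg_mx f : 'M[F]_#|G| := \sum_x (f x)%:~R *: rG x.

Lemma galg_mxM f g : galg_mx (f * g) = galg_mx f *m galg_mx g.
Proof.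
rewrite /galg_mx mulmx_suml.
under [RHS]eq_bigr => x _.
  rewrite mulmx_sumr (reindex_inj (mulgI x^-1%g)) /=.
  under eq_bigr => y _ do
    rewrite -scalemxAl -scalemxAr scalerA -repr_mxM ?inE // mulKVg -intrM.
  over.
rewrite exchange_big /=; apply: eq_bigr => y _.
by rewrite galgM rmorph_sum scaler_suml.
Qed.

Lemma galg_mx_gel x : galg_mx (gel x) = rG x.
Proof.
rewrite /galg_mx (bigD1 x) //= gelE eqxx scale1r big1 ?addr0 // => y /negPf n.
by rewrite gelE n scale0r.
Qed.

Lemma galg_mxMz f c : galg_mx (f *~ c) = c%:~R *: galg_mx f.
Proof.
rewrite /galg_mx scaler_sumr; apply: eq_bigr => x _.
by rewrite galgMz intrM scalerA.
Qed.

Lemma galg_mxD : {morph galg_mx : f g / f + g}.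
Proof.
move=> f g; rewrite /galg_mx -big_split; apply: eq_bigr => x _.
by rewrite galgD intrD scalerDl.
Qed.

Lemma galg_mx0 : galg_mx 0 = 0.
Proof. by rewrite /galg_mx big1 // => x _; rewrite galg0 scale0r. Qed.

Lemma galg_mx_sum (I : finType) (P : pred I) (f : I -> galg gT) :
  galg_mx (\sum_(i | P i) f i) = \sum_(i | P i) galg_mx (f i).
Proof. exact: (big_morph _ galg_mxD galg_mx0). Qed.

Lemma gring_row_regular x i : gring_row (rG x) 0 i = (enum_val i == x)%:R.
Proof.
rewrite /gring_row rowK mxE eqxx /= gring_indexK ?inE // mul1g.
by rewrite -(inj_eq enum_val_inj) gring_indexK ?inE.
Qed.

Lemma gring_row_galg f i : gring_row (galg_mx f) 0 i = (f (enum_val i))%:~R.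
Proof.
rewrite /galg_mx linear_sum summxE (bigD1 (enum_val i)) //= linearZ mxE.
rewrite gring_row_regular eqxx mulr1 big1 ?addr0 // => x n.
by rewrite linearZ mxE gring_row_regular eq_sym (negPf n) mulr0.
Qed.

End RegularGalg.

Lemma irr_charE (F : fieldType) (n : nat) (la : intpart n) (s : 'S_n) :
  [pchar F] =i pred0 ->
  irr_char F la s
    = (young_coef la)%:~R^-1 * (conj_sum (young la) s)%:~R.
Proof.
move=> char0; pose rG := regular_repr F [set: 'S_n]%G.
have k0 : (young_coef la)%:~R != 0 :> F.
  by rewrite intr_eq0_char0 // gt_eqF // young_coef_gt0.
set k := (young_coef la)%:~R in k0 *.
have vE : young_symmetrizer F la = gring_row (galg_mx F (young la)).
  rewrite /young_symmetrizer exchange_big /= /young /rsum /wsum.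
  rewrite [csum _ * _]mulr_suml galg_mx_sum linear_sum; apply: eq_bigr => q _.
  rewrite mulr_sumr galg_mx_sum linear_sum; apply: eq_bigr => p _.
  rewrite mulrzAl mul_gel galg_mxMz galg_mx_gel linearZ /=.
  by rewrite rmorph_sign.
rewrite /irr_char; set v := young_symmetrizer F la in vE *.
(* Left multiplication by the idempotent k^-1 * [young]; it commutes with the regular action, which
   multiplies on the right. *)
pose P : 'M_#|[set: 'S_n]| := \matrix_i (k^-1 *: (v *m rG (enum_val i))).
have PC x : P *m rG x = rG x *m P.
  apply/row_matrixP => i; rewrite !row_mul rowK /= rowK -rowE rowK.
  by rewrite -scalemxAl -mulmxA gring_indexK ?inE // repr_mxM ?inE.
have vP : v *m P = v.
  rewrite mulmx_sum_row.
  transitivity (k^-1 *: (v *m galg_mx F (young la))).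
    rewrite mulmx_sumr scaler_sumr.
    rewrite [RHS]sum_setT_enum_val.
    apply: eq_bigr => i _; rewrite rowK vE gring_row_galg -scalemxAr.
    by rewrite !scalerA mulrC.
  rewrite vE -gring_row_mul -galg_mxM youngM galg_mxMz linearZ scalerA mulVf //.
  by rewrite scale1r.
set Umod := cyclic_mx_module _ _.
rewrite (@mxtrace_submod_proj _ _ _ _ _ _ P) ?inE //.
- rewrite /mxtrace -conj_sum_youngV /conj_sum rmorph_sum mulr_sumr.
  rewrite [RHS]sum_setT_enum_val.
  apply: eq_bigr => i _.
  have -> : (P *m rG s) i i = row i (P *m rG s) 0 i by rewrite [RHS]mxE.
  rewrite row_mul rowK -scalemxAl mxE -mulmxA -repr_mxM ?inE // vE -gring_row_mul.
  by rewrite -galg_mx_gel -galg_mxM gring_row_galg Mgel invMg mulgA.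
- apply/row_subP => i; rewrite rowK scalemx_sub //.
  by rewrite mxmodule_trans ?inE // cyclic_mx_id.
- have sU : (cyclic_mx rG v <= kermx (P - 1%:M))%MS.
    apply: cyclic_mx_sub; last by apply/sub_kermxP; rewrite mulmxBr vP mulmx1 subrr.
    apply: kermx_centg_module; apply/centgmxP => x _.
    by rewrite mulmxBl mulmxBr PC mulmx1 mul1mx.
  by move/sub_kermxP: sU; rewrite mulmxBr mulmx1 => /eqP; rewrite subr_eq0 => /eqP.
Qed.

(** * Words and contingency tables *)

Local Open Scope nat_scope.

Definition content n (T : finType) (w : {ffun 'I_n -> T}) (t : T) : nat :=
  #|[pred x | w x == t]|.

Definition has_content n (T : finType) (f : T -> nat) (w : {ffun 'I_n -> T}) :=
  [forall t, content w t == f t].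

(** As a function of s, the permutation character on the words of content f. *)
Definition nfix n (T : finType) (f : T -> nat) (s : 'S_n) : nat :=
  #|[pred w : {ffun 'I_n -> T} | has_content f w && (s \in wstab w)]|.

Section Words.
Variables (n : nat) (T : finType).
Implicit Types (w : {ffun 'I_n -> T}) (f : T -> nat) (s g : 'S_n).

Lemma has_contentP f w : reflect (content w =1 f) (has_content f w).
Proof. by apply: (iffP forallP) => h t; apply/eqP. Qed.

Lemma content_sum w : \sum_t content w t = n.
Proof.
rewrite -[RHS]card_ord -sum1_card (partition_big w xpredT) //=.
by apply: eq_bigr => t _; rewrite sum1_card.
Qed.

Lemma content_conj w w' :
  content w =1 content w' -> exists g : 'S_n, forall x, w' x = w (g x).
Proof.
move=> e.
have cE (v : {ffun 'I_n -> T}) t : count_mem t [tuple v i | i < n] = content v t.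
  by rewrite /content -sum1_card -sum1_count big_map val_ord_tuple big_enum_cond.
have : perm_eq [tuple w' i | i < n] [tuple w i | i < n].
  by apply/allP => t _ /=; rewrite !cE e.
case/tuple_permP => g /val_inj eg; exists g => x.
by have := congr1 (fun t => tnth t x) eg; rewrite !tnth_mktuple.
Qed.

Lemma content_exists f : \sum_t f t = n -> exists w, content w =1 f.
Proof.
move=> fn; pose l := flatten [seq nseq (f t) t | t <- enum T].
have sl : size l == n.
  rewrite size_flatten /shape -map_comp sumnE big_map big_enum /= -[X in _ == X]fn.
  by apply/eqP; apply: eq_bigr => t _; rewrite size_nseq.
exists [ffun i => tnth (Tuple sl) i] => t.
transitivity (count_mem t (Tuple sl)).
  rewrite -[in RHS](map_tnth_enum (Tuple sl)) /content -sum1_card -sum1_count.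
  by rewrite big_map big_enum_cond; apply: eq_bigl => i; rewrite inE ffunE.
rewrite /= /l count_flatten -map_comp sumnE big_map big_enum /= (bigD1 t) //=.
rewrite count_nseq /= eqxx mul1n big1 ?addn0 // => u nut.
by rewrite count_nseq /= (negPf nut).
Qed.

Lemma nfixE f s : nfix f s = \sum_(w | has_content f w) (s \in wstab w).
Proof.
rewrite /nfix -sum1_card.
rewrite (eq_bigl (fun w => has_content f w && (s \in wstab w))) // big_mkcondr.
by apply: eq_bigr => w _; case: ifP.
Qed.

(* Burnside's lemma for the transitive action on the words of a given content. *)
Lemma sum_nfix f w0 : content w0 =1 f -> \sum_(s : 'S_n) nfix f s = n`!.
Proof.
move=> c0; pose act g : {ffun 'I_n -> T} := [ffun x => w0 (g x)].
transitivity (\sum_(w | has_content f w) #|[pred g | act g == w]|).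
  rewrite (eq_bigr _ (fun s _ => nfixE f s)).
  rewrite exchange_big /=; apply: eq_bigr => w /has_contentP cw.
  have [g wg] : exists g : 'S_n, forall x, w x = w0 (g x).
    by apply: content_conj => t; rewrite cw c0.
  rewrite -sum1_card [RHS]big_mkcond [RHS](reindex_inj (mulIg g)) /=.
  apply: eq_bigr => s _; rewrite -[RHS]/((act (s * g)%g == w) : nat); congr nat_of_bool.
  apply/wstabP/eqP => [ws|e x].
    by apply/ffunP => x; rewrite ffunE permM -wg ws.
  by rewrite wg -permM -[RHS]/(w x) -[in RHS]e ffunE.
have -> : n`! = \sum_(g : 'S_n) 1 by rewrite sum1_card card_Sn.
rewrite (partition_big act (has_content f)) /=.
  by apply: eq_bigr => w _; rewrite sum1_card.
move=> g _; apply/has_contentP => t; rewrite -c0.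
apply: etrans (card_perm_comp g (fun x => w0 x == t)).
by apply: eq_card => x; rewrite !inE ffunE.
Qed.

End Words.

Section WordPairs.
Variables (n : nat) (T T' : finType).
Implicit Types (f : T -> nat) (h : T' -> nat).

Definition margins f h : {pred {ffun T * T' -> 'I_n.+1}} :=
  [pred F : {ffun T * T' -> 'I_n.+1} | [forall t, \sum_t' F (t, t') == f t]
    && [forall t', \sum_t F (t, t') == h t']].

(** A pair of words is a word over the product alphabet, whose content is a contingency table with
    margins f and h; Burnside's lemma contributes n! for each table. *)
Lemma sum_nfixM f h : \sum_t f t = n ->
  \sum_(s : 'S_n) nfix f s * nfix h s = n`! * #|margins f h|.
Proof.
move=> fn; pose pairw (v : {ffun 'I_n -> T * T'}) s :=
  [&& has_content f [ffun x => (v x).1], has_content h [ffun x => (v x).2]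
    & s \in wstab v].
transitivity (\sum_(s : 'S_n) #|[pred v | pairw v s]|).
  apply: eq_bigr => s _; rewrite -cardX.
  pose zipw (u : {ffun 'I_n -> T} * {ffun 'I_n -> T'}) : {ffun 'I_n -> T * T'} :=
    [ffun x => (u.1 x, u.2 x)].
  pose unzipw (v : {ffun 'I_n -> T * T'}) : {ffun 'I_n -> T} * {ffun 'I_n -> T'} :=
    ([ffun x => (v x).1], [ffun x => (v x).2]).
  have zK : cancel zipw unzipw.
    by case=> u v; congr pair; apply/ffunP => x; rewrite !ffunE.
  have uK : cancel unzipw zipw.
    by move=> v; apply/ffunP => x; rewrite !ffunE; case: (v x).
  rewrite -!sum1_card [RHS](reindex zipw) /=; last first.
    by apply: onW_bij; exists unzipw.
  apply: eq_bigl => -[u u'].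
  rewrite -[LHS]/((has_content f u && (s \in wstab u))
    && (has_content h u' && (s \in wstab u'))).
  rewrite -[RHS]/(pairw (zipw (u, u')) s) /pairw.
  have -> : [ffun x => (zipw (u, u') x).1] = u by apply/ffunP => x; rewrite !ffunE.
  have -> : [ffun x => (zipw (u, u') x).2] = u' by apply/ffunP => x; rewrite !ffunE.
  have -> : (s \in wstab (zipw (u, u'))) = (s \in wstab u) && (s \in wstab u').
    apply/wstabP/andP => [e|[/wstabP h1 /wstabP h2] x]; last by rewrite !ffunE /= h1 h2.
    by split; apply/wstabP => x; have := e x; rewrite !ffunE /= => -[].
  by rewrite -!andbA; do !bool_congr.
pose cF (v : {ffun 'I_n -> T * T'}) : {ffun T * T' -> 'I_n.+1} :=
  [ffun p => inord (content v p)].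
have content_fst (v : {ffun 'I_n -> T * T'}) t : content [ffun x => (v x).1] t = \sum_t' content v (t, t').
  rewrite /content -sum1_card (partition_big (fun x => (v x).2) xpredT) //=.
  apply: eq_bigr => t' _; rewrite -sum1_card; apply: eq_bigl => x.
  by rewrite !inE ffunE; case: (v x).
have content_snd (v : {ffun 'I_n -> T * T'}) t' : content [ffun x => (v x).2] t' = \sum_t content v (t, t').
  rewrite /content -sum1_card (partition_big (fun x => (v x).1) xpredT) //=.
  apply: eq_bigr => t _; rewrite -sum1_card; apply: eq_bigl => x.
  by rewrite !inE ffunE andbC; case: (v x).
have cFE (v : {ffun 'I_n -> T * T'}) p : cF v p = content v p :> nat.
  rewrite ffunE inordK // ltnS; apply: leq_trans (max_card _) _.
  by rewrite card_ord.
have pairwE v s : pairw v s = (cF v \in margins f h) && (s \in wstab v).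
  rewrite /pairw andbA; congr (_ && _); rewrite inE; congr (_ && _).
    by apply: eq_forallb => t; rewrite content_fst; under [in RHS]eq_bigr do rewrite cFE.
  by apply: eq_forallb => t; rewrite content_snd; under [in RHS]eq_bigr do rewrite cFE.
transitivity (\sum_(s : 'S_n) \sum_(F in margins f h) nfix (fun p => F p : nat) s).
  apply: eq_bigr => s _; rewrite -sum1_card (partition_big cF (mem (margins f h))) /=.
    apply: eq_bigr => F mF; rewrite /nfix -sum1_card; apply: eq_bigl => v.
    rewrite -[LHS]/(pairw v s && (cF v == F)) pairwE.
    rewrite -[RHS]/(has_content (fun p => F p : nat) v && (s \in wstab v)).
    have -> : has_content (fun p => F p : nat) v = (cF v == F).
      apply/has_contentP/eqP => [e|<- p]; last by rewrite cFE.
      by apply/ffunP => p; apply: val_inj; rewrite /= cFE e.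
    by case: eqP => [->|]; rewrite ?andbF // mF andbT.
  by move=> v; rewrite -[X in X -> _]/(pairw v s : Prop) pairwE => /andP[].
rewrite exchange_big /= mulnC -sum_nat_const; apply: eq_bigr => F.
rewrite inE => /andP[/forallP mF _].
have [|v cv] := @content_exists n _ (fun p => F p : nat).
  transitivity (\sum_t \sum_t' F (t, t')).
    by rewrite pair_bigA; apply: eq_bigr => -[].
  by apply: etrans fn; apply: eq_bigr => t _; apply/eqP.
exact: sum_nfix cv.
Qed.

End WordPairs.

Local Open Scope ring_scope.

Local Open Scope nat_scope.

(** * Counting 3 x 3 contingency tables *)

Definition o0 : 'I_3 := @Ordinal 3 0 isT.
Definition o1 : 'I_3 := @Ordinal 3 1 isT.
Definition o2 : 'I_3 := @Ordinal 3 2 isT.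

Lemma ord3P (P : 'I_3 -> Prop) : P o0 -> P o1 -> P o2 -> forall i, P i.
Proof.
move=> P0 P1 P2 [[|[|[|i]]] // lti].
- by rewrite (_ : Ordinal lti = o0) //; apply: val_inj.
- by rewrite (_ : Ordinal lti = o1) //; apply: val_inj.
- by rewrite (_ : Ordinal lti = o2) //; apply: val_inj.
Qed.

Lemma sum_ord3 (f : 'I_3 -> nat) : \sum_i f i = f o0 + f o1 + f o2.
Proof.
rewrite !big_ord_recl big_ord0 addn0 addnA.
by congr (f _ + f _ + f _); apply: val_inj.
Qed.

Lemma forall_ord3 (P : pred 'I_3) : [forall i, P i] = [&& P o0, P o1 & P o2].
Proof.
apply/forallP/and3P => [h|[p0 p1 p2]]; first by split.
by apply: ord3P.
Qed.

Definition c3 (a b e : nat) (i : 'I_3) : nat := nth 0 [:: a; b; e] i.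

(* The number of 3 x 3 tables with row sums a, b, e, column sums c, _, d and       *)
(* entries x, y, z at (1,3), (3,1), (3,3); only the (1,1) entry is still free.     *)
Definition fiber_card a b e c d x y z : nat :=
  if [&& y + z <= e, x + z <= d, x <= a & y <= c]
  then (minn (a - x) (c - y)).+1 - (c + d - (b + x + y + z)) else 0.

Section MarginFiber.
Variables (n a b e c d e' : nat) (x y z : bool).
Hypotheses (sum_row : a + b + e = n) (sum_col : c + d + e' = n).
Hypotheses (e_le1 : e <= 1) (e'_le1 : e' <= 1).

(** The margins and the three corner entries x, y, z determine the table from its (1,1) entry m. *)
Let entry (m : nat) : seq (seq nat) :=
  [:: [:: m; a - m - x; (x : nat)];
      [:: c - m - y; b - (c - m - y) - (e' - x - z); e' - x - z];
      [:: (y : nat); e - y - z; (z : nat)]].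

Let build (m : 'I_n.+1) : {ffun 'I_3 * 'I_3 -> 'I_n.+1} :=
  [ffun p : 'I_3 * 'I_3 => inord (nth 0 (nth [::] (entry m) p.1) p.2)].

(** The conditions under which the truncated subtractions in [entry] are exact. *)
Let ok (m : nat) : bool :=
  [&& y + z <= e, x + z <= e', m + x <= a, m + y <= c
    & c + e' <= b + m + x + y + z].

Lemma card_margin_fiber :
  #|[pred F in @margins n _ _ (c3 a b e) (c3 c d e')
     | [&& F (o0, o2) == x :> nat, F (o2, o0) == y :> nat
         & F (o2, o2) == z :> nat]]|
    = fiber_card a b e c e' x y z.
Proof.
transitivity #|[pred m : 'I_n.+1 | ok m]|; last first.
  rewrite /fiber_card /ok; case: ifP => h; last first.
    by apply: eq_card0 => m; rewrite !inE; lia.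
  set lo := c + e' - (b + x + y + z); set hi := minn (a - x) (c - y).
  rewrite cardE -(size_map val) -[RHS](size_iota lo); apply: perm_size.
  apply: uniq_perm; rewrite ?iota_uniq ?(map_inj_uniq val_inj) ?enum_uniq //.
  move=> m; rewrite mem_iota; apply/mapP/idP => [[k]|h2].
    by rewrite mem_enum inE => hk ->; move: hk => /=; lia.
  have ltm : m < n.+1 by lia.
  by exists (Ordinal ltm) => //; rewrite mem_enum inE /=; lia.
rewrite -(@card_in_image _ _ build [pred m : 'I_n.+1 | ok m]); last first.
  move=> m k _ _ /ffunP/(_ (o0, o0)); rewrite !ffunE /= => /(congr1 val) /=.
  by rewrite !inordK // => /val_inj.
have ffun9 (F G : {ffun 'I_3 * 'I_3 -> 'I_n.+1}) :
    [&& F (o0, o0) == G (o0, o0) :> nat, F (o0, o1) == G (o0, o1) :> nat,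
        F (o0, o2) == G (o0, o2) :> nat, F (o1, o0) == G (o1, o0) :> nat,
        F (o1, o1) == G (o1, o1) :> nat, F (o1, o2) == G (o1, o2) :> nat,
        F (o2, o0) == G (o2, o0) :> nat, F (o2, o1) == G (o2, o1) :> nat
      & F (o2, o2) == G (o2, o2) :> nat] -> F = G.
  do 8![move=> /andP[/eqP ? +]] => /eqP ?.
  apply/ffunP => -[i j]; apply: val_inj.
  by elim/ord3P: i; elim/ord3P: j.
have buildP (F : {ffun 'I_3 * 'I_3 -> 'I_n.+1}) (m : 'I_n.+1) : m = F (o0, o0) ->
    [&& m + F (o0, o1) + F (o0, o2) == a,
      F (o1, o0) + F (o1, o1) + F (o1, o2) == b,
      F (o2, o0) + F (o2, o1) + F (o2, o2) == e,
      m + F (o1, o0) + F (o2, o0) == c, F (o0, o1) + F (o1, o1) + F (o2, o1) == d,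
      F (o0, o2) + F (o1, o2) + F (o2, o2) == e' &
      [&& F (o0, o2) == x :> nat, F (o2, o0) == y :> nat & F (o2, o2) == z :> nat]] ->
    ok m /\ F = build m.
  move=> m00 /and5P[/eqP r0 /eqP r1 /eqP r2 /eqP k0 /and5P[/eqP k1 /eqP k2 /eqP ex /eqP ey /eqP ez]].
  have e01 : a - m - x = F (o0, o1) by clear -r0 ex; lia.
  have e10 : c - m - y = F (o1, o0) by clear -k0 ey; lia.
  have e12 : e' - x - z = F (o1, o2) by clear -k2 ex ez; lia.
  have e21 : e - y - z = F (o2, o1) by clear -r2 ey ez; lia.
  have e11 : b - (c - m - y) - (e' - x - z) = F (o1, o1).
    by rewrite e10 e12; clear -r1; lia.
  split; first by rewrite /ok; apply/and5P; split; clear e01 e10 e12 e21 e11; lia.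
  apply: ffun9; rewrite !ffunE /= e11 e01 e10 e12 e21 -ex -ey -ez !inord_val m00.
  by rewrite !eqxx.
apply: eq_card => F; apply/idP/imageP => [|[m]].
  rewrite !inE !forall_ord3 !sum_ord3 /c3 /= => FP.
  have [|okm FE] := buildP F _ erefl; first by move: FP; rewrite -?andbA.
  by exists (F (o0, o0)).
rewrite inE => /and5P[h1 h2 h3 h4 h5] ->; rewrite !inE !forall_ord3 !sum_ord3 /c3 !ffunE /=.
have r0 : m + (a - m - x) + x = a by clear -h3; lia.
have k0 : m + (c - m - y) + y = c by clear -h4; lia.
have r2 : y + (e - y - z) + z = e by clear -h1; lia.
have k2 : x + (e' - x - z) + z = e' by clear -h2; lia.
move: (a - m - x) (c - m - y) (e - y - z) (e' - x - z) r0 k0 r2 k2 => p q r t r0 k0 r2 k2.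
have r1 : q + (b - q - t) + t = b by clear -h5 k0 k2; lia.
move: (b - q - t) r1 => v r1.
have [ltp ltq ltr ltt ltv] : [/\ p < n.+1, q < n.+1, r < n.+1, t < n.+1 & v < n.+1].
  by split; clear -sum_row sum_col r0 k0 r2 k2 r1; lia.
have [ltx lty ltz] : [/\ x < n.+1, y < n.+1 & z < n.+1].
  by split; clear -sum_row sum_col r0 k0 r2 k2 r1; lia.
by rewrite !inordK //; clear -sum_row sum_col r0 k0 r2 k2 r1; lia.
Qed.

End MarginFiber.

(** Since e and e' are at most 1, the entries in the last row and column are 0 or 1, and the tables
    split according to the three corners. *)
Lemma card_margins n a b e c d e' :
  a + b + e = n -> c + d + e' = n -> e <= 1 -> e' <= 1 ->
  #|@margins n _ _ (c3 a b e) (c3 c d e')|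
    = \sum_(x : bool) \sum_(y : bool) \sum_(z : bool) fiber_card a b e c e' x y z.
Proof.
move=> sr sc le1 le1'.
pose sel (F : {ffun 'I_3 * 'I_3 -> 'I_n.+1}) :=
  ((F (o0, o2) == 1 :> nat), ((F (o2, o0) == 1 :> nat), (F (o2, o2) == 1 :> nat))).
rewrite -sum1_card (partition_big sel xpredT) //=.
transitivity (\sum_(p : bool * (bool * bool)) fiber_card a b e c e' p.1 p.2.1 p.2.2).
  apply: eq_bigr => -[x [y z]] _ /=.
  rewrite -(card_margin_fiber x y z sr sc le1 le1') -sum1_card; apply: eq_bigl => F.
  rewrite !inE !forall_ord3 !sum_ord3 /c3 /sel /= !xpair_eqE.
  apply: andb_id2l => /andP[/and3P[r0 r1 r2] /and3P[k0 k1 k2]].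
  by case: x; case: y; case: z; lia.
rewrite -(pair_bigA _ (fun (x : bool) (q : bool * bool) => fiber_card a b e c e' x q.1 q.2)) /=.
apply: eq_bigr => x _.
by rewrite -(pair_bigA _ (fun y z : bool => fiber_card a b e c e' x y z)).
Qed.

Local Open Scope ring_scope.

(** * Irreducible characters as virtual permutation characters *)

Section Pairing.
Variables (n : nat) (la : intpart n).
Implicit Types (s g : 'S_n).

Lemma sum_conj_nfix (T : finType) (f : T -> nat) (x : galg 'S_n) :
  \sum_(s : 'S_n) conj_sum x s * (nfix f s)%:Z
    = \sum_(w : {ffun 'I_n -> T} | has_content f w) conj_form x (wsum w).
Proof.
transitivity (\sum_(s : 'S_n) \sum_(w : {ffun 'I_n -> T} | has_content f w)
    conj_sum x s * (s \in wstab w)%:R).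
  by apply: eq_bigr => s _; rewrite nfixE -natz natr_sum mulr_sumr.
rewrite exchange_big /=; apply: eq_bigr => w _.
rewrite /wsum conj_form_sumr [RHS](reindex_inj invg_inj) [RHS]big_mkcond /=.
apply: eq_bigr => s _; rewrite wstabV conj_form_gel.
by case: ifP; rewrite ?mulr1 ?mulr0.
Qed.

Lemma young_pair0 (T : finType) (f : T -> nat) :
  (forall w : {ffun 'I_n -> T}, content w =1 f ->
     exists x y, [/\ x != y, tcol la x = tcol la y & w x = w y]) ->
  \sum_(s : 'S_n) conj_sum (young la) s * (nfix f s)%:Z = 0.
Proof.
move=> h; rewrite sum_conj_nfix big1 // => w /has_contentP cw.
apply: conj_form_young_wsum0 => g.
have [|x [y [nxy cxy wxy]]] := h [ffun x => w (g x)].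
  move=> t; rewrite -cw; apply: etrans (card_perm_comp g (fun x => w x == t)).
  by apply: eq_card => x; rewrite !inE ffunE.
by exists x, y; split=> //; move: wxy; rewrite !ffunE.
Qed.

(** Pigeonhole: there are more letters [o0] than columns, so some column contains two of them. *)
Lemma young_pair0_wide (f : 'I_3 -> nat) :
  (nth 0 la 0 < f o0)%N ->
  \sum_(s : 'S_n) conj_sum (young la) s * (nfix f s)%:Z = 0.
Proof.
move=> lt0; apply: young_pair0 => w cw; set A := [pred x | w x == o0].
have cA : (nth 0 la 0 < #|A|)%N by rewrite -[X in (_ < X)%N]/(content w o0) cw.
have lt0c x : (tcol la x < nth 0 la 0)%N.
  exact: leq_trans (tcol_lt la x) (intpart_nth_anti _ _).
pose c x := Ordinal (lt0c x).
have : ~~ dinjectiveb c A.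
  apply/negP => /dinjectiveP c_inj; have := card_in_image c_inj.
  have := max_card (mem (image c A)); rewrite card_ord.
  by move=> + e; rewrite e leqNgt cA.
case/dinjectivePn => x Ax [y /andP[nyx Ay] cxy]; exists x, y.
split; [by rewrite eq_sym | exact: (congr1 val cxy) |].
by move: Ax Ay; rewrite !inE => /eqP-> /eqP->.
Qed.

(** The first column has three cells, but only two letters are available. *)
Lemma young_pair0_tall (f : 'I_3 -> nat) :
  (2 < size la)%N -> f o2 = 0%N ->
  \sum_(s : 'S_n) conj_sum (young la) s * (nfix f s)%:Z = 0.
Proof.
move=> size3 f2; apply: young_pair0 => w cw.
have cell i : (i < 3)%N -> exists2 x, trow la x = i & tcol la x = 0%N.
  by move=> lti; apply: tcell; apply: intpart_gt0; apply: leq_trans size3.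
have [x0 r0 c0] := cell 0%N isT; have [x1 r1 c1] := cell 1%N isT.
have [x2 r2 c2] := cell 2%N isT.
have no2 : [pred x | w x == o2] =i pred0 by apply: card0_eq; apply: etrans (cw o2) f2.
have w01 x : w x = o0 \/ w x = o1.
  have := no2 x; rewrite !inE; elim/ord3P: (w x); [by left | by right | by rewrite eqxx].
have neq x y : trow la x != trow la y -> x != y by apply: contraNneq => ->.
have n01 : x0 != x1 by apply: neq; rewrite r0 r1.
have n02 : x0 != x2 by apply: neq; rewrite r0 r2.
have n12 : x1 != x2 by apply: neq; rewrite r1 r2.
case: (w01 x0) (w01 x1) (w01 x2) => e0 [] e1 [] e2;
  by [exists x0, x1; rewrite n01 c0 c1 e0 e1 | exists x0, x2; rewrite n02 c0 c2 e0 e2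
     | exists x1, x2; rewrite n12 c1 c2 e1 e2].
Qed.

Lemma card_wstab (T : eqType) (w : 'I_n -> T) :
  #|wstab w|%:R = \sum_s wsum w s :> int.
Proof.
rewrite -sum1_card natr_sum big_mkcond; apply: eq_bigr => s _.
by rewrite wsumE; case: (s \in _).
Qed.

Lemma wsum_comp (T : eqType) (w : 'I_n -> T) g :
  wsum (fun x => w (g x)) = gel g * wsum w * gel g^-1.
Proof.
apply/ffunP => s; rewrite Mgel gelM !wsumE invgK; congr ((_ : bool)%:R).
apply/wstabP/wstabP => h x; last by have := h (g x); rewrite !permM permK.
by have := h (g^-1%g x); rewrite !permM !permKV.
Qed.

(** All words of content la are rearrangements of the word of row numbers, so each contributes the
    order of its stabilizer times [young_coef la]; by Burnside these orders add up to n!. *)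
Lemma young_pair1 : (size la <= 3)%N ->
  \sum_(s : 'S_n) conj_sum (young la) s
      * (nfix (fun i : 'I_3 => nth 0%N la i) s)%:Z
    = n`!%:Z * young_coef la.
Proof.
move=> size3; rewrite sum_conj_nfix; set f := fun i : 'I_3 => _.
have row3 x : (trow la x < 3)%N.
  apply: leq_trans size3; rewrite ltnNge; apply/negP => le.
  by have := tcol_lt la x; rewrite nth_default.
pose w0 : {ffun 'I_n -> 'I_3} := [ffun x => inord (trow la x)].
have c0 : content w0 =1 f.
  move=> i; rewrite /f -card_trow; apply: eq_card => x; rewrite !inE ffunE.
  by rewrite -val_eqE /= inordK.
have w0E : wsum w0 = rsum la.
  apply/ffunP => s; rewrite /rsum !wsumE; congr ((_ : bool)%:R).
  apply/wstabP/wstabP => h x; last by rewrite !ffunE h.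
  by have := congr1 val (h x); rewrite !ffunE /= !inordK.
transitivity (\sum_(w : {ffun 'I_n -> 'I_3} | has_content f w) #|wstab w|%:R * young_coef la).
  apply: eq_bigr => w /has_contentP cw.
  have [|g wg] := @content_conj _ _ w0 w; first by move=> t; rewrite c0 cw.
  have -> : wsum w = gel g * rsum la * gel g^-1.
    rewrite -w0E -wsum_comp; apply/ffunP => s; rewrite !wsumE.
    congr ((_ : bool)%:R).
    by apply/wstabP/wstabP => h x; have := h x; rewrite !wg.
  rewrite conj_formJ conj_form_young_rsum; congr (_ * _).
  rewrite -natz row_stabE !card_wstab.
  rewrite [RHS](eq_bigr (fun s => (gel g * rsum la * gel g^-1) s)); last first.
    move=> s _; rewrite -w0E -wsum_comp !wsumE; congr ((_ : bool)%:R).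
    by apply/wstabP/wstabP => h x; have := h x; rewrite !wg.
  rewrite (reindex_inj (@conjg_inj _ g)) /=; apply: eq_bigr => s _.
  by rewrite Mgel gelM invgK /conjg !mulgA.
rewrite -mulr_suml; congr (_ * _); rewrite -natz -(sum_nfix c0) natr_sum.
rewrite (eq_bigr (fun w : {ffun 'I_n -> 'I_3} => \sum_(s : 'S_n) (s \in wstab w)%:R)).
  by rewrite exchange_big; apply: eq_bigr => s _; rewrite nfixE natr_sum.
by move=> w _; rewrite card_wstab; apply: eq_bigr => s _; rewrite wsumE.
Qed.

(** The hypotheses and [conj_form_young] make the sum of the squares of the differences vanish,
    which over the integers forces every difference to be 0. *)
Lemma conj_sum_young_virtual (X : 'S_n -> int) :
  \sum_s X s * X s = n`!%:Z ->
  \sum_s conj_sum (young la) s * X s = n`!%:Z * young_coef la ->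
  forall s, conj_sum (young la) s = young_coef la * X s.
Proof.
move=> XX CX; set k := young_coef la in CX *.
have CC : \sum_s conj_sum (young la) s * conj_sum (young la) s = n`!%:Z * k ^+ 2.
  rewrite -conj_form_young -card_Sn; apply: etrans (conj_sum_pair _ _).
  by apply: eq_bigr => s _; rewrite conj_sum_youngV.
have : \sum_s (conj_sum (young la) s - k * X s) ^+ 2 = 0.
  transitivity (\sum_s (conj_sum (young la) s * conj_sum (young la) s
      - k * 2 * (conj_sum (young la) s * X s) + k ^+ 2 * (X s * X s))).
    by apply: eq_bigr => s _; ring.
  by rewrite big_split sumrB -!mulr_sumr CC CX XX /=; ring.
move/eqP; rewrite psumr_eq0 => [/allP h s|s _]; last exact: sqr_ge0.
have := h s (mem_index_enum s); rewrite /= sqrf_eq0 subr_eq0 => /eqP //.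
Qed.
End Pairing.

(** * Jacobi-Trudi combinations and their norms *)

Lemma eq_nfix n (T : finType) (f g : T -> nat) (s : 'S_n) :
  f =1 g -> nfix f s = nfix g s.
Proof.
move=> fg; apply: eq_card => w; rewrite !inE; congr (_ && _).
by apply: eq_forallb => t; rewrite fg.
Qed.

Definition hfix n (t : nat * nat * nat) (s : 'S_n) : int :=
  (nfix (c3 t.1.1 t.1.2 t.2) s)%:Z.

Definition vcomb n (l : seq (int * (nat * nat * nat))) (s : 'S_n) : int :=
  \sum_(t <- l) t.1 * hfix t.2 s.

(** The number of tables with row sums t and column sums u, by [card_margins]; the middle column sum
    is determined by the others. *)
Definition margin_count (t u : nat * nat * nat) : nat :=
  \sum_(x : bool) \sum_(y : bool) \sum_(z : bool)
    fiber_card t.1.1 t.1.2 t.2 u.1.1 u.2 x y z.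

Definition shape_of n (t : nat * nat * nat) : bool :=
  (t.1.1 + t.1.2 + t.2 == n)%N && (t.2 <= 1)%N.

Lemma sum_hfixM n t u : shape_of n t -> shape_of n u ->
  \sum_(s : 'S_n) hfix t s * hfix u s = n`!%:Z * (margin_count t u)%:Z.
Proof.
case: t u => [[a b] e] [[c d] e'] /andP[/eqP /= st le1] /andP[/eqP /= su le1'].
rewrite -PoszM /margin_count -(card_margins st su le1 le1') /=.
rewrite -(sum_nfixM (f := c3 a b e)); last by rewrite sum_ord3.
by rewrite -natz natr_sum; apply: eq_bigr => s _; rewrite natz PoszM.
Qed.

Lemma sum_vcomb_sq n l : all (fun t => shape_of n t.2) l ->
  \sum_(s : 'S_n) vcomb l s * vcomb l s
    = n`!%:Z * \sum_(t <- l) \sum_(u <- l) t.1 * u.1 * (margin_count t.2 u.2)%:Z.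
Proof.
move=> /allP shl; rewrite mulr_sumr.
transitivity (\sum_(t <- l) \sum_(s : 'S_n) t.1 * hfix t.2 s * vcomb l s).
  by rewrite exchange_big; apply: eq_bigr => s _; rewrite mulr_suml.
rewrite !big_seq; apply: eq_bigr => t lt; rewrite mulr_sumr.
transitivity (\sum_(u <- l) \sum_(s : 'S_n) t.1 * hfix t.2 s * (u.1 * hfix u.2 s)).
  by rewrite exchange_big; apply: eq_bigr => s _; rewrite mulr_sumr.
rewrite !big_seq; apply: eq_bigr => u lu.
rewrite mulrCA -sum_hfixM ?shl // mulr_sumr; apply: eq_bigr => s _.
by rewrite mulrACA.
Qed.

Lemma sum_young_vcomb n (la : intpart n) l :
  \sum_(s : 'S_n) conj_sum (young la) s * vcomb l s
    = \sum_(t <- l) t.1 * \sum_(s : 'S_n) conj_sum (young la) s * hfix t.2 s.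
Proof.
transitivity (\sum_(t <- l) \sum_s conj_sum (young la) s * (t.1 * hfix t.2 s)).
  by rewrite exchange_big; apply: eq_bigr => s _; rewrite mulr_sumr.
apply: eq_bigr => t _; rewrite mulr_sumr; apply: eq_bigr => s _.
by rewrite mulrCA.
Qed.

(** The 2 x 2 Jacobi-Trudi determinant for (a, b); for b = 0 its second term is absent. *)
Definition vcomb2 (a b : nat) : seq (int * (nat * nat * nat)) :=
  (1, (a, b, 0%N)) :: if b is b'.+1 then [:: (-1, (a.+1, b', 0%N))] else [::].

(* The Jacobi-Trudi expansion of the Schur function of (a, b + 1, 1). *)
Definition vcomb3 (a b : nat) : seq (int * (nat * nat * nat)) :=
  [:: (1, (a, b.+1, 1%N)); (-1, (a, b.+2, 0%N)); (-1, (a.+1, b, 1%N));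
      (1, (a.+2, b, 0%N))].

Ltac count_margins :=
  rewrite /margin_count !big_bool /fiber_card /=; do ?case: ifP => ?; lia.

Lemma vcomb2_sq (a b : nat) : (b <= a)%N ->
  \sum_(t <- vcomb2 a b) \sum_(u <- vcomb2 a b)
    t.1 * u.1 * (margin_count t.2 u.2)%:Z = 1.
Proof.
have AA c d : (d <= c)%N -> margin_count (c, d, 0%N) (c, d, 0%N) = d.+1.
  by move=> le; count_margins.
case: b => [|b] leba; rewrite !(big_cons, big_nil) /= ?AA // 1?ltnW //; try lia.
have AB : margin_count (a, b.+1, 0%N) (a.+1, b, 0%N) = b.+1 by count_margins.
have BA : margin_count (a.+1, b, 0%N) (a, b.+1, 0%N) = b.+1 by count_margins.
by rewrite AB BA; lia.
Qed.

Lemma vcomb3_sq (a b : nat) : (b < a)%N ->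
  \sum_(t <- vcomb3 a b) \sum_(u <- vcomb3 a b)
    t.1 * u.1 * (margin_count t.2 u.2)%:Z = 1.
Proof.
(* In the border case a = b + 1 four of the counts drop by one; their signs make the corrections
   cancel. *)
move=> leba; pose d := nat_of_bool (a == b.+1); rewrite !(big_cons, big_nil) /=.
have -> : margin_count (a, b.+1, 1) (a, b.+1, 1) = (5 * b + 7 - d)%N.
  by rewrite /d; case: eqP => ?; count_margins.
have -> : margin_count (a, b.+1, 1) (a, b.+2, 0) = (2 * b + 4 - d)%N.
  by rewrite /d; case: eqP => ?; count_margins.
have -> : margin_count (a, b.+2, 0) (a, b.+1, 1) = (2 * b + 4 - d)%N.
  by rewrite /d; case: eqP => ?; count_margins.
have -> : margin_count (a, b.+2, 0) (a, b.+2, 0) = (b + 3 - d)%N.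
  by rewrite /d; case: eqP => ?; count_margins.
have -> : margin_count (a, b.+1, 1) (a.+1, b, 1) = (5 * b + 3)%N by count_margins.
have -> : margin_count (a.+1, b, 1) (a, b.+1, 1) = (5 * b + 3)%N by count_margins.
have -> : margin_count (a, b.+1, 1) (a.+2, b, 0) = (2 * b + 1)%N by count_margins.
have -> : margin_count (a.+2, b, 0) (a, b.+1, 1) = (2 * b + 1)%N by count_margins.
have -> : margin_count (a, b.+2, 0) (a.+1, b, 1) = (2 * b + 2)%N by count_margins.
have -> : margin_count (a.+1, b, 1) (a, b.+2, 0) = (2 * b + 2)%N by count_margins.
have -> : margin_count (a, b.+2, 0) (a.+2, b, 0) = (b + 1)%N by count_margins.
have -> : margin_count (a.+2, b, 0) (a, b.+2, 0) = (b + 1)%N by count_margins.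
have -> : margin_count (a.+1, b, 1) (a.+1, b, 1) = (5 * b + 2)%N by count_margins.
have -> : margin_count (a.+1, b, 1) (a.+2, b, 0) = (2 * b + 1)%N by count_margins.
have -> : margin_count (a.+2, b, 0) (a.+1, b, 1) = (2 * b + 1)%N by count_margins.
have -> : margin_count (a.+2, b, 0) (a.+2, b, 0) = (b + 1)%N by count_margins.
by rewrite /d; case: (a == _); lia.
Qed.

Section YoungVirtual.
Variables (n : nat) (la : intpart n).

Definition two_rows (a b : nat) : seq nat := if b is 0 then [:: a] else [:: a; b].

Lemma young_pair_diag a b e : (forall i : 'I_3, nth 0%N la i = c3 a b e i) ->
  (size la <= 3)%N ->
  \sum_(s : 'S_n) conj_sum (young la) s * hfix (a, b, e) s = n`!%:Z * young_coef la.
Proof.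
move=> laE size3; rewrite -young_pair1 //; apply: eq_bigr => s _.
by rewrite /hfix /= (@eq_nfix _ _ _ _ _ laE).
Qed.

(** The leading term pairs to n! times [young_coef la]; the other has more letters [o0] than la has
    columns. *)
Lemma conj_sum_two_rows a b : (b <= a)%N -> la = two_rows a b :> seq nat ->
  forall s : 'S_n, conj_sum (young la) s = young_coef la * vcomb (vcomb2 a b) s.
Proof.
move=> leba laE; have sumab : (a + b = n)%N.
  by rewrite -(intpart_sum la) laE; case: (b) => [|b'] /=; lia.
apply: conj_sum_young_virtual.
  rewrite sum_vcomb_sq; first by rewrite vcomb2_sq ?mulr1.
  by rewrite /vcomb2; case: (b) sumab => [|b'] sumab; rewrite /= /shape_of /=; lia.
have diag : \sum_(s : 'S_n) conj_sum (young la) s * hfix (a, b, 0%N) s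
    = n`!%:Z * young_coef la.
  apply: young_pair_diag; rewrite laE; last by case: (b).
  by elim/ord3P; case: (b).
rewrite sum_young_vcomb /vcomb2 big_cons /= mul1r diag.
case: (b) laE => [|b'] laE; rewrite ?big_nil ?addr0 //.
rewrite big_seq1 /= (young_pair0_wide (f := c3 _ _ _)) ?mulr0 ?addr0 //.
by rewrite laE.
Qed.

(** Of the non-leading terms, (a, b + 2, 0) has too few letters for three rows, and the other two
    have too many letters [o0] for the first row. *)
Lemma conj_sum_three_rows a b : (b < a)%N -> la = [:: a; b.+1; 1%N] :> seq nat ->
  forall s : 'S_n, conj_sum (young la) s = young_coef la * vcomb (vcomb3 a b) s.
Proof.
move=> leba laE; have sumab : (a + b.+2 = n)%N.
  by rewrite -(intpart_sum la) laE /=; lia.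
apply: conj_sum_young_virtual.
  rewrite sum_vcomb_sq; first by rewrite vcomb3_sq ?mulr1.
  by rewrite /vcomb3 /= /shape_of /=; lia.
have diag : \sum_(s : 'S_n) conj_sum (young la) s * hfix (a, b.+1, 1%N) s
    = n`!%:Z * young_coef la.
  by apply: young_pair_diag; rewrite laE //; elim/ord3P.
rewrite sum_young_vcomb !(big_cons, big_nil) /= mul1r diag.
rewrite (young_pair0_tall (f := c3 _ _ _)) ?laE //.
rewrite (young_pair0_wide (f := c3 _ _ _)) ?laE //=.
by rewrite (young_pair0_wide (f := c3 _ _ _)) ?laE //= !mulr0 !addr0.
Qed.
End YoungVirtual.

(** * Decomposition of the cocharacter *)

Section Telescoping.
Variables (n : nat) (s : 'S_n).

Local Notation h a b e := (@hfix n (a : nat, b : nat, e : nat)%N s).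
Local Notation v2 a b := (vcomb (vcomb2 a b) s).
Local Notation v3 a b := (vcomb (vcomb3 a b) s).

Lemma hfix_relabel (r : 'S_3) (t u : nat * nat * nat) :
  (forall i, c3 t.1.1 t.1.2 t.2 (r i) = c3 u.1.1 u.1.2 u.2 i) -> hfix t s = hfix u s.
Proof.
move=> tu; rewrite /hfix /nfix; congr Posz.
pose rl (w : {ffun 'I_n -> 'I_3}) : {ffun 'I_n -> 'I_3} := [ffun x => r (w x)].
have rl_inj : injective rl.
  move=> w w' /ffunP e; apply/ffunP => x; have := e x; rewrite !ffunE.
  exact: perm_inj.
rewrite -!sum1_card [LHS](reindex rl) /=; last exact: onW_bij (injF_bij rl_inj).
apply: eq_bigl => w.
rewrite -[LHS]/(has_content (c3 t.1.1 t.1.2 t.2) (rl w) && (s \in wstab (rl w))).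
rewrite -[RHS]/(has_content (c3 u.1.1 u.1.2 u.2) w && (s \in wstab w)).
have cE i : content (rl w) (r i) = content w i.
  by apply: eq_card => x; rewrite !inE ffunE (inj_eq perm_inj).
congr (_ && _).
  apply/has_contentP/has_contentP => e i; first by rewrite -cE e tu.
  by rewrite -[i](permKV r) cE e tu.
apply/wstabP/wstabP => e x; last by rewrite !ffunE e.
by have := e x; rewrite !ffunE => /perm_inj.
Qed.

Lemma hfixC a b : h a b 0 = h b a 0.
Proof.
apply: (@hfix_relabel (tperm o0 o1)); elim/ord3P.
- by rewrite tpermL.
- by rewrite tpermR.
- by rewrite tpermD.
Qed.

Lemma hfix1C a b : h a b 1 = h b a 1.
Proof.
apply: (@hfix_relabel (tperm o0 o1)); elim/ord3P.
- by rewrite tpermL.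
- by rewrite tpermR.
- by rewrite tpermD.
Qed.

Lemma hfix10 a : h a 0 1 = h a 1 0.
Proof.
apply: (@hfix_relabel (tperm o1 o2)); elim/ord3P.
- by rewrite tpermD.
- by rewrite tpermL.
- by rewrite tpermR.
Qed.

Lemma vcomb20 a : v2 a 0%N = h a 0 0.
Proof. by rewrite /vcomb big_seq1 mul1r. Qed.

Lemma vcomb2S a b : v2 a b.+1 = h a b.+1 0 - h a.+1 b 0.
Proof. by rewrite /vcomb big_cons big_seq1 /= mul1r mulN1r. Qed.

Lemma vcomb2_skew a : v2 a a.+1 = 0.
Proof. by rewrite vcomb2S hfixC subrr. Qed.

Lemma vcomb3E a b :
  v3 a b = h a b.+1 1 - h a b.+2 0 - h a.+1 b 1 + h a.+2 b 0.
Proof. by rewrite /vcomb !(big_cons, big_nil) /= !mul1r !mulN1r addr0 !addrA. Qed.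

(** Unfolding the recursion writes g a b as the sum of D (a + b - p) p over p <= b, and by symmetry
    over p <= min(a, b). Each p then occurs for the k with p <= k <= N - p, which are N + 1 - 2p in
    number, or none. *)
Lemma sum_telescope (g D : nat -> nat -> int) (N : nat) :
  (forall a b, g a b = g b a) -> (forall a, g a 0%N = D a 0%N) ->
  (forall a b, g a b.+1 = D a b.+1 + g a.+1 b) ->
  \sum_(k < N.+1) g k (N - k)%N
    = \sum_(p < N.+1) (N.+1 - 2 * p)%:Z * D (N - p)%N p.
Proof.
move=> gC g0 gS.
have tele a b : g a b = \sum_(p < b.+1) D (a + b - p)%N p.
  elim: b a => [|b IHb] a; first by rewrite big_ord1 addn0 subn0.
  by rewrite big_ord_recr /= gS IHb addrC addnK addSnnS.
have expand (k : 'I_N.+1) : g k (N - k)%N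
    = \sum_(p < N.+1 | (p <= k)%N && (p <= N - k)%N) D (N - p)%N p.
  have ltk := ltn_ord k.
  wlog le : k ltk / (N - k <= k)%N => [wl|].
    case: (leqP (N - k) k) => [|lt]; first exact: wl.
    have := wl (rev_ord k) (ltn_ord _); rewrite /= subSS subKn ?leq_ord // => wlk.
    by rewrite gC wlk ?(ltnW lt) //; apply: eq_bigl => p; rewrite andbC.
  rewrite tele subnKC ?leq_ord // (big_ord_widen N.+1 (fun p => D (N - p)%N p)).
    by apply: eq_bigl => p; lia.
  by lia.
under eq_bigr => k _ do rewrite expand.
rewrite (exchange_big_dep xpredT) //=; apply: eq_bigr => p _.
rewrite sumr_const -mulr_natl natz; congr (Posz _ * _).
rewrite cardE -(size_map val) -[RHS](size_iota p); apply: perm_size.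
apply: uniq_perm; rewrite ?iota_uniq ?(map_inj_uniq val_inj) ?enum_uniq //.
move=> k; rewrite mem_iota; apply/mapP/idP => [[i]|hk].
  by rewrite mem_enum unfold_in => hi ->; have := ltn_ord i; move: hi => /=; lia.
have ltk : (k < N.+1)%N by lia.
by exists (Ordinal ltk) => //; rewrite mem_enum unfold_in /=; lia.
Qed.

Definition two_row_mult (b : nat) : nat :=
  if (2 * b <= n)%N then (if b is 0 then 2 * n + 3 else 3 * (n - 2 * b + 1))%N else 0%N.

Lemma sum_hfix_decomposition : (0 < n)%N ->
  2 * h n 0 0 + \sum_(k < n.+1) h k (n - k) 0 + \sum_(k < n) h k (n.-1 - k) 1
    = \sum_(b < n.+1) (two_row_mult b)%:Z * v2 (n - b)%N b
      + \sum_(b < n) (n - 2 * b - 2)%:Z * v3 (n - b - 2)%N b.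
Proof.
move=> n_gt0.
rewrite (sum_telescope (g := fun a b => h a b 0) (D := fun a b => v2 a b)) //; last first.
- by move=> a b; rewrite vcomb2S subrK.
- by move=> a; rewrite vcomb20.
- exact: hfixC.
(* Pieri's rule: adding a cell to (a, b) gives (a, b, 1), (a, b + 1) and (a + 1, b), the first only
   if b > 0. It supplies the differences D for the contents with one letter [o2]. *)
pose v3' a b : int := if b is b'.+1 then v3 a b' else 0 : int.
have -> : \sum_(k < n) h k (n.-1 - k) 1
    = \sum_(p < n) (n - 2 * p)%:Z *
        (v3' (n.-1 - p)%N p + v2 (n.-1 - p)%N p.+1 + v2 (n.-1 - p).+1 p).
  have := @sum_telescope (fun a b => h a b 1)
    (fun a b => v3' a b + v2 a b.+1 + v2 a.+1 b) n.-1.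
  rewrite prednK // => -> //; first exact: hfix1C.
    by move=> a; rewrite /v3' add0r vcomb2S vcomb20 hfix10 subrK.
  by move=> a b; rewrite /v3' vcomb3E !vcomb2S; ring.
have shift (f : nat -> nat -> int) N : \sum_(b < N) (N - 2 * b - 2)%:Z * f (N - b - 2)%N b
    = \sum_(p < N) (N - 2 * p)%:Z * (if (p : nat) is b.+1 then f (N.-1 - p)%N b else 0) :> int.
  case: N => [|N]; first by rewrite !big_ord0.
  rewrite big_ord_recr [RHS]big_ord_recl /= mulr0 add0r.
  rewrite (_ : (_ - _ - 2)%N = 0%N); last by lia.
  rewrite mul0r addr0; apply: eq_bigr => b _.
  by congr (Posz _ * f _ _); rewrite /bump /=; lia.
rewrite (shift (fun a b => v3 a b)).
have S3 : \sum_(p < n) (n - 2 * p)%:Z * v2 (n.-1 - p).+1 p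
    = \sum_(b < n.+1) (n - 2 * b)%:Z * v2 (n - b)%N b.
  rewrite [RHS]big_ord_recr /= (_ : (n - 2 * n)%N = 0%N); last by lia.
  rewrite mul0r addr0; apply: eq_bigr => p _; have := ltn_ord p => ltp.
  by rewrite (_ : (n.-1 - p).+1 = (n - p)%N); last by lia.
under [X in _ + X = _]eq_bigr do rewrite !mulrDr.
rewrite !big_split /= S3 !big_ord_recl /= subn0 vcomb20 /two_row_mult muln0 subn0 /=.
set V := \sum_(p < n) _ * v3' _ _.
suff -> : \sum_(i < n) (two_row_mult (bump 0 i))%:Z * v2 (n - bump 0 i)%N (bump 0 i)
    = \sum_(i < n) (n.+1 - 2 * bump 0 i)%:Z * v2 (n - bump 0 i)%N (bump 0 i)
      + \sum_(i < n) (n - 2 * i)%:Z * v2 (n.-1 - i)%N i.+1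
      + \sum_(i < n) (n - 2 * bump 0 i)%:Z * v2 (n - bump 0 i)%N (bump 0 i).
  have -> : (2 * n + 3)%N%:Z = 2 * n%:Z + 3 by lia.
  have -> : n.+1%:Z = n%:Z + 1 by lia.
  ring.
rewrite -!big_split; apply: eq_bigr => i _ /=; rewrite /bump /= add1n.
rewrite (_ : (n.-1 - i)%N = (n - i.+1)%N); last by lia.
(* With b = i + 1, the three coefficients of a genuine partition add up to 3(n - 2b + 1); beyond the
   border all truncated coefficients are 0, and on it the shape is (b - 1, b), whose virtual
   character vanishes. *)
case: (ltngtP (2 * i.+1) n.+1) => [lt|gt|eq].
- rewrite /two_row_mult -ltnS lt -!mulrDl; congr (_ * _); lia.
- rewrite /two_row_mult leqNgt (ltnW gt) /=.
  have -> : (n.+1 - 2 * i.+1)%N = 0%N by lia.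
  have -> : (n - 2 * i.+1)%N = 0%N by lia.
  have -> : (n - 2 * i)%N = 0%N by lia.
  by rewrite !mul0r !addr0.
have -> : (n - i.+1)%N = i by lia.
by rewrite vcomb2_skew !mulr0 !addr0.
Qed.

End Telescoping.

(** * Multiplicities and linear independence of the characters *)

Section Multiplicities.
Variable n : nat.
Hypothesis n_gt0 : (0 < n)%N.
Implicit Types la : intpart n.

Definition gen_mult la : nat :=
  match parts la with
  | [:: _] => 2 * n + 3
  | [:: a; b] => 3 * (a - b + 1)
  | [:: a; b; 1] => a - b + 1
  | _ => 0
  end%N.

Definition three_rows (a b : nat) : seq nat := [:: a; b.+1; 1%N].

Lemma sum_delta N (f : nat -> nat) c : (c < N)%N ->
  (\sum_(b < N) f b * (b == c :> nat) = f c)%N.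
Proof.
move=> ltc; rewrite (bigD1 (Ordinal ltc)) //= eqxx muln1 big1 ?addn0 // => b nb.
by rewrite -(inj_eq val_inj) /= in nb; rewrite (negPf nb) muln0.
Qed.

(** Indexes the multiplicities by the second row, to match the two sums of [sum_hfix_decomposition];
    indices that give no partition have coefficient 0. *)
Lemma gen_multE la : gen_mult la =
  (\sum_(b < n.+1) two_row_mult n b * (parts la == two_rows (n - b) b)
   + \sum_(b < n) (n - 2 * b - 2) * (parts la == three_rows (n - b - 2) b))%N.
Proof.
have sumla := intpart_sum la; have gt0 := @intpart_gt0 _ la.
have anti := @intpart_nth_anti _ la.
rewrite /gen_mult; move: (parts la) sumla gt0 anti => l sl gt0 anti.
case: l => [|a [|b [|c [|d l]]]] in sl gt0 anti *.
- by move: n_gt0; rewrite -sl.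
- rewrite [X in _ = (_ + X)%N]big1 ?addn0; last first.
    by move=> i _; rewrite /three_rows eqseq_cons /= andbF muln0.
  rewrite (eq_bigr (fun b : 'I_n.+1 => two_row_mult n b * (b == 0 :> nat)))%N.
    by rewrite sum_delta //.
  move=> [b ltb] _ /=; congr (_ * nat_of_bool _)%N.
  case: b ltb => [|b] ltb /=; last by rewrite eqseq_cons andbF.
  by rewrite subn0 -sl /= addn0 eqxx.
- have b_gt0 : (0 < b)%N := gt0 1%N isT; have leba : (b <= a)%N := anti 0%N 1%N isT.
  rewrite [X in _ = (_ + X)%N]big1 ?addn0; last first.
    by move=> i _; rewrite /three_rows !eqseq_cons /= !andbF muln0.
  rewrite (eq_bigr (fun i : 'I_n.+1 => two_row_mult n i * (i == b :> nat)))%N.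
    rewrite sum_delta /two_row_mult; last by move: sl => /=; lia.
    case: b sl b_gt0 leba {gt0 anti} => // b /= sl _ leba; rewrite ifT; lia.
  move=> [i lti] _ /=; congr (_ * nat_of_bool _)%N.
  case: i lti => [|i] lti /=; first by rewrite eqseq_cons andbF; case: (b) b_gt0.
  by rewrite !eqseq_cons andbT; move: sl => /=; lia.
- rewrite [X in _ = (X + _)%N]big1 ?add0n; last first.
    by move=> [[|i] lti] _; rewrite /two_rows !eqseq_cons /= ?andbF muln0.
  have b_gt0 : (0 < b)%N := gt0 1%N isT; have leba : (b <= a)%N := anti 0%N 1%N isT.
  case: c => [|[|c]] in sl gt0 anti *.
  + by have := gt0 2%N isT.
  + rewrite (eq_bigr (fun i : 'I_n => (n - 2 * i - 2) * (i == b.-1 :> nat)))%N.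
      by rewrite (sum_delta (fun i => n - 2 * i - 2)%N); move: sl => /=; lia.
    move=> [i lti] _ /=; congr (_ * nat_of_bool _)%N.
    by rewrite /three_rows !eqseq_cons /= eqxx andbT; move: sl => /=; lia.
  + by rewrite [RHS]big1 // => i _; rewrite /three_rows !eqseq_cons /= !andbF muln0.
rewrite !big1; first by case: c {sl gt0 anti} => [|[]].
  by move=> i _; rewrite /three_rows !eqseq_cons /= !andbF muln0.
by move=> [[|i] lti] _; rewrite /two_rows !eqseq_cons /= ?andbF muln0.
Qed.

Lemma is_intpart_two_rows b : (2 * b <= n)%N -> is_intpart n (two_rows (n - b) b).
Proof.
move=> le; rewrite /is_intpart /two_rows.
by case: b le => [|b] le /=; rewrite ?subn0 ?addn0 ?n_gt0 ?eqxx //=; lia.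
Qed.

Lemma is_intpart_three_rows b :
  (2 * b + 2 < n)%N -> is_intpart n (three_rows (n - b - 2) b).
Proof. by move=> le; rewrite /is_intpart /three_rows /=; lia. Qed.

Section IrreducibleCharacters.
Variables (F : fieldType) (char0 : [pchar F] =i pred0).

Lemma irr_char_virtual la (X : 'S_n -> int) :
  (forall s, conj_sum (young la) s = young_coef la * X s) ->
  forall s, irr_char F la s = (X s)%:~R.
Proof.
move=> CX s; rewrite irr_charE // CX intrM mulKf // intr_eq0_char0 //.
by rewrite gt_eqF // young_coef_gt0.
Qed.

Lemma sum_parts l (lP : is_intpart n l) (G : intpart n -> F) :
  \sum_la (parts la == l)%:R * G la = G (IntPart lP).
Proof.
rewrite (bigD1 (IntPart lP)) //= eqxx mul1r big1 ?addr0 // => la.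
by rewrite -val_eqE /= => /negPf ->; rewrite mul0r.
Qed.

Lemma sum_gen_mult_irr_char s :
  \sum_la (gen_mult la)%:R * irr_char F la s
    = (2 * hfix (n, 0, 0)%N s + \sum_(k < n.+1) hfix (k : nat, n - k, 0)%N s
       + \sum_(k < n) hfix (k : nat, n.-1 - k, 1)%N s)%:~R.
Proof.
rewrite sum_hfix_decomposition // rmorphD !rmorph_sum /=.
transitivity (\sum_(b < n.+1) \sum_la (two_row_mult n b)%:R
      * ((parts la == two_rows (n - b) b)%:R * irr_char F la s)
    + \sum_(b < n) \sum_la (n - 2 * b - 2)%:R
      * ((parts la == three_rows (n - b - 2) b)%:R * irr_char F la s)).
  rewrite exchange_big [X in _ = _ + X]exchange_big -big_split /=.
  apply: eq_bigr => la _; rewrite gen_multE natrD mulrDl !natr_sum !mulr_suml.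
  by congr (_ + _); apply: eq_bigr => b _; rewrite natrM mulrA.
congr (_ + _); apply: eq_bigr => b _; rewrite -mulr_sumr intrM.
  case: (leqP (2 * b) n) => le; last by rewrite /two_row_mult leqNgt le !mul0r.
  rewrite (sum_parts (is_intpart_two_rows le)); congr (_ * _).
  by apply: irr_char_virtual; apply: conj_sum_two_rows => //; lia.
case: (ltnP (2 * b + 2) n) => [lt|le]; last first.
  by rewrite (_ : (n - 2 * b - 2)%N = 0%N) ?mul0r //; lia.
rewrite (sum_parts (is_intpart_three_rows lt)); congr (_ * _).
by apply: irr_char_virtual; apply: conj_sum_three_rows => //; lia.
Qed.

(** Pairing the relation with the class function of [young mu] isolates c mu, multiplied by factors
    that are nonzero in characteristic zero. *)
Lemma irr_char_free (c : intpart n -> F) :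
  (forall s, \sum_la c la * irr_char F la s = 0) -> forall la, c la = 0.
Proof.
move=> sum0 mu.
have CC la : \sum_s irr_char F la s * (conj_sum (young mu) s^-1)%:~R
    = (la == mu)%:R * ((n`!)%:R * (young_coef mu)%:~R) :> F.
  transitivity ((young_coef la)%:~R^-1 *
      (n`!%:Z * conj_form (young la) (young mu))%:~R : F).
    rewrite -card_Sn -conj_sum_pair rmorph_sum mulr_sumr; apply: eq_bigr => s _.
    by rewrite irr_charE // rmorphM mulrA.
  case: eqP => [->|/eqP neq]; last by rewrite conj_form_young_neq // !mulr0 mul0r.
  rewrite conj_form_young mul1r expr2 !intrM [_^-1 * _]mulrCA; congr (_ * _).
  by rewrite mulKf // intr_eq0_char0 // gt_eqF // young_coef_gt0.
have : \sum_s (\sum_la c la * irr_char F la s) * (conj_sum (young mu) s^-1)%:~R = 0 :> F.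
  by apply: big1 => s _; rewrite sum0 mul0r.
under eq_bigr => s _ do rewrite mulr_suml.
rewrite exchange_big (bigD1 mu) //= [X in _ + X]big1 ?addr0; last first.
  move=> la /negPf neq; under eq_bigr => s _ do rewrite -mulrA.
  by rewrite -mulr_sumr CC neq mul0r mulr0.
under eq_bigr => s _ do rewrite -mulrA.
rewrite -mulr_sumr CC eqxx mul1r => /eqP; rewrite !mulf_eq0.
have /negPf -> : n`!%:R != 0 :> F by rewrite (pcharf0P F).1 // -lt0n fact_gt0.
have /negPf -> : (young_coef mu)%:~R != 0 :> F.
  by rewrite intr_eq0_char0 // gt_eqF // young_coef_gt0.
by rewrite !orbF => /eqP.
Qed.
End IrreducibleCharacters.

End Multiplicities.

(** * Upper triangular matrices and evaluation *)

Section UpperTriangular.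
Variable F : fieldType.
Implicit Types (u v w : UT2 F) (t : 'I_3) (i j : bool).

(* The letters [o0], [o1], [o2] stand for the entries (1,1), (2,2), (1,2). *)
Definition ut2_entry t u : F :=
  nth 0 [:: (u : 'M[F]_2) 0 0; (u : 'M[F]_2) 1 1; (u : 'M[F]_2) 0 1] t.

(* [false] and [true] stand for the first and the second row or column. *)
Definition ut2_unit i j : UT2 F :=
  if i then (if j then ut2_e22 F else 0)
  else (if j then ut2_e12 F else 1 - ut2_e22 F).

Definition letter_row t : bool := t == o1.
Definition letter_col t : bool := t != o0.

Lemma ut2_10 u : (u : 'M[F]_2) 1 0 = 0.
Proof. by have /is_trig_mxP trigu := valP u; rewrite -(trigu 0 1 isT) mxE. Qed.

Lemma ut2_mxN u : (- u : UT2 F) = - (u : 'M[F]_2) :> 'M[F]_2.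
Proof. exact: (raddfN (\val : UT2 F -> 'M[F]_2)). Qed.

Lemma ut2_mx0 : (0 : UT2 F) = 0 :> 'M[F]_2.
Proof. exact: (raddf0 (\val : UT2 F -> 'M[F]_2)). Qed.

Lemma ut2_entry_inj u v : (forall t, ut2_entry t u = ut2_entry t v) -> u = v.
Proof.
move=> e; apply: val_inj; apply/matrixP => i j.
have := (e o0, e o1, e o2); rewrite /ut2_entry /= => -[[e0 e1] e2].
have two (k : 'I_2) : k = 0 \/ k = 1.
  by case: k => [[|[|k]] ltk] //; [left | right]; apply: val_inj.
case: (two i) (two j) => -> [] -> //.
by rewrite -[LHS]/((u : 'M[F]_2) 1 0) ut2_10 -[RHS]/((v : 'M[F]_2) 1 0) ut2_10.
Qed.

Lemma ut2_entry_linear t : linear (ut2_entry t : UT2 F -> F^o).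
Proof.
by move=> c u v; rewrite /ut2_entry ut2_mxD ut2_mxZ !mxE; elim/ord3P: t.
Qed.

HB.instance Definition _ t :=
  GRing.isLinear.Build F (UT2 F) F^o _ (ut2_entry t) (ut2_entry_linear t).

Lemma ut2_entry0 t : ut2_entry t 0 = 0.
Proof. exact: linear0. Qed.

Lemma ut2_entryZ t c u : ut2_entry t (c *: u) = c * ut2_entry t u.
Proof. exact: linearZ. Qed.

Lemma ut2_entryP t c u v : ut2_entry t (c *: u + v) = c * ut2_entry t u + ut2_entry t v.
Proof. exact: linearP. Qed.

Lemma ut2_entry_sum t (I : finType) (P : pred I) (G : I -> UT2 F) :
  ut2_entry t (\sum_(i | P i) G i) = \sum_(i | P i) ut2_entry t (G i).
Proof. exact: linear_sum. Qed.

Lemma ut2_entryM u v :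
  [/\ ut2_entry o0 (u * v) = ut2_entry o0 u * ut2_entry o0 v,
      ut2_entry o1 (u * v) = ut2_entry o1 u * ut2_entry o1 v
    & ut2_entry o2 (u * v)
        = ut2_entry o0 u * ut2_entry o2 v + ut2_entry o2 u * ut2_entry o1 v].
Proof.
have l1 : lift 0 0 = 1 :> 'I_2 by apply: val_inj.
rewrite /ut2_entry ut2_mxM !mxE !big_ord_recl !big_ord0 !addr0 l1 /=; split=> //.
  by rewrite ut2_10 mulr0 addr0.
by rewrite ut2_10 mul0r add0r.
Qed.

Lemma ut2_entry_unit t i j :
  ut2_entry t (ut2_unit i j) = ((letter_row t == i) && (letter_col t == j))%:R.
Proof.
rewrite /ut2_unit; case: i; case: j;
 rewrite /ut2_entry ?(ut2_mxD, ut2_mxN, ut2_mx1, ut2_mx0) !mxE;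
 elim/ord3P: t; rewrite /= ?subrr ?subr0 //.
Qed.

(** The implications say that the outer matrix units lie on or above the diagonal; [ut2_unit] is 0
    below it. *)
Lemma ut2_unit_sandwich t u i j : (i ==> letter_row t) -> (letter_col t ==> j) ->
  ut2_unit i (letter_row t) * u * ut2_unit (letter_col t) j
    = ut2_entry t u *: ut2_unit i j.
Proof.
move=> hi hj; apply: ut2_entry_inj => t'.
have [M0 M1 M2] := ut2_entryM (ut2_unit i (letter_row t) * u) (ut2_unit (letter_col t) j).
have [N0 N1 N2] := ut2_entryM (ut2_unit i (letter_row t)) u.
rewrite ut2_entryZ.
by elim/ord3P: t' => /=; rewrite ?M0 ?M1 ?M2 ?N0 ?N1 ?N2 !ut2_entry_unit;
  elim/ord3P: t hi hj {M0 M1 M2 N0 N1 N2}; case: i; case: j => //= _ _;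
  rewrite ?(mulr0, mul0r, mulr1, mul1r, addr0, add0r).
Qed.

Lemma ut2_unitE u :
  u = \sum_t ut2_entry t u *: ut2_unit (letter_row t) (letter_col t).
Proof.
apply: ut2_entry_inj => t; rewrite ut2_entry_sum (bigD1 t) //= ut2_entryZ.
rewrite ut2_entry_unit !eqxx mulr1 big1 ?addr0 // => t' nt.
rewrite ut2_entryZ ut2_entry_unit.
by elim/ord3P: t nt; elim/ord3P: t' => //= _; rewrite mulr0.
Qed.

Definition ut2_letter t : UT2 F := ut2_unit (letter_row t) (letter_col t).

Lemma ut2_entry_letter t t' : ut2_entry t (ut2_letter t') = (t == t')%:R.
Proof.
by rewrite /ut2_letter ut2_entry_unit; elim/ord3P: t; elim/ord3P: t'.
Qed.

Definition strictly_upper u : bool := (ut2_entry o0 u == 0) && (ut2_entry o1 u == 0).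

Lemma strictly_upperMl u v : strictly_upper u -> strictly_upper (u * v).
Proof.
case/andP=> /eqP u0 /eqP u1; have [M0 M1 _] := ut2_entryM u v.
by rewrite /strictly_upper M0 M1 u0 u1 !mul0r eqxx.
Qed.

Lemma strictly_upperMr u v : strictly_upper v -> strictly_upper (u * v).
Proof.
case/andP=> /eqP v0 /eqP v1; have [M0 M1 _] := ut2_entryM u v.
by rewrite /strictly_upper M0 M1 v0 v1 !mulr0 eqxx.
Qed.

Lemma strictly_upperM0 u v : strictly_upper u -> strictly_upper v -> u * v = 0.
Proof.
case/andP=> /eqP u0 /eqP u1 /andP[/eqP v0 /eqP v1]; have [M0 M1 M2] := ut2_entryM u v.
apply: ut2_entry_inj => t; rewrite ut2_entry0.
by elim/ord3P: t; rewrite ?M0 ?M1 ?M2 ?u0 ?u1 ?v0 ?v1 ?mulr0 ?mul0r ?addr0.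
Qed.

Lemma strictly_upper_prod (l : seq (UT2 F)) :
  (0 < count strictly_upper l)%N -> strictly_upper (\prod_(u <- l) u).
Proof.
elim: l => //= u l IHl; rewrite big_cons; case: (boolP (strictly_upper u)) => su.
  by rewrite strictly_upperMl.
by move/IHl; apply: strictly_upperMr.
Qed.

Lemma strictly_upper_prod0 (l : seq (UT2 F)) :
  (1 < count strictly_upper l)%N -> \prod_(u <- l) u = 0.
Proof.
elim: l => //= u l IHl; rewrite big_cons; case: (boolP (strictly_upper u)) => su.
  by rewrite ltnS => /strictly_upper_prod; apply: strictly_upperM0.
by move/IHl->; rewrite mulr0.
Qed.

End UpperTriangular.

Section Evaluation.
Variable F : fieldType.
Implicit Types (f g : freeW F) (a : nat -> UT2 F) (u v w : UT2 F).

HB.instance Definition _ a :=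
  GRing.isLinear.Build F (freeW F) (UT2 F) _ (weval a) (freeW_lift_linear _).

Lemma wevalP a (c : F) f g : weval a (c *: f + g) = c *: weval a f + weval a g :> UT2 F.
Proof. exact: freeW_lift_linear. Qed.

Lemma weval0 a : weval a 0 = 0 :> UT2 F.
Proof. exact: linear0. Qed.

Lemma wmonomial_ut2 (l : seq (UT2 F * UT2 F)) w :
  l != [::] -> wmonomial l w = (\prod_(q <- l) (q.1 * q.2)) * w.
Proof.
case: l => // p l _; rewrite big_cons.
suff h x : foldl (fun b q => wmul b (wlact q.1 q.2)) x l
    = x * \prod_(q <- l) (q.1 * q.2) :> UT2 F by rewrite /wmonomial h.
elim: l x => [|q l IHl] x /=; first by rewrite big_nil mulr1.
by rewrite IHl big_cons mulrA.
Qed.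

Lemma weval_word a p s wn : weval a (word F (p, s, wn))
  = (\prod_(q <- p :: s) (ut2_basis F q.1 * a q.2)) * ut2_basis F wn.
Proof.
rewrite /weval freeW_lift_word wmonomial_ut2 //; congr (_ * _).
by rewrite -(big_map (fun q : 'I_3 * nat => (ut2_basis F q.1, a q.2)) xpredT (fun q => q.1 * q.2)).
Qed.

Lemma weval_lift a (G : 'I_3 -> wword) w :
  weval a (ut2_lift (fun b => word F (G b)) w)
    = \sum_b ut2_coord b w *: weval a (word F (G b)).
Proof.
by rewrite /ut2_lift linear_sum; apply: eq_bigr => b _; rewrite linearZ.
Qed.

Lemma weval_lact a w f : weval a (wlact w f) = w * weval a f.
Proof.
apply: (freeW_ext (f1 := fun f => weval a (wlact w f)) (f2 := fun f => w * weval a f)).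
- by move=> c g h; rewrite wlact_linearr linearP.
- by move=> c g h; rewrite linearP mulrDr scalerAr.
move=> [[[w0 j] s] wn].
rewrite weval_word big_cons [(_, _).1]/= !mulrA.
rewrite -[wlact w _]/(freeW_lact w _) /freeW_lact freeW_lift_word /word_lact weval_lift.
rewrite [w * ut2_basis F w0 in RHS]ut2_coordE !mulr_suml.
apply: eq_bigr => b _; rewrite weval_word big_cons [(_, _).1]/= -!scalerAl.
by rewrite ?mulrA.
Qed.

Lemma weval_ract a w f : weval a (wract f w) = weval a f * w.
Proof.
apply: (freeW_ext (f1 := fun f => weval a (wract f w)) (f2 := fun f => weval a f * w)).
- by move=> c g h; rewrite wract_linearl linearP.
- by move=> c g h; rewrite linearP mulrDl scalerAl.
move=> [[p s] wn].
rewrite weval_word -mulrA.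
rewrite -[wract _ w]/(freeW_ract _ w) /freeW_ract freeW_lift_word /word_ract weval_lift.
rewrite [ut2_basis F wn * w in RHS]ut2_coordE mulr_sumr.
by apply: eq_bigr => b _; rewrite weval_word -scalerAr.
Qed.

Lemma prod_cat_cons (T : Type) (l1 l2 : seq T) x (G : T -> UT2 F) :
  \prod_(q <- l1 ++ x :: l2) G q = \prod_(q <- l1) G q * (G x * \prod_(q <- l2) G q).
Proof. by rewrite big_cat big_cons. Qed.

Lemma weval_mul a f g : weval a (wmul f g) = weval a f * weval a g.
Proof.
apply: (freeW_ext (f1 := fun f => weval a (wmul f g)) (f2 := fun f => weval a f * weval a g)).
- by move=> c ? ?; rewrite wmul_linearl linearP.
- by move=> c ? ?; rewrite linearP mulrDl scalerAl.
move=> k.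
apply: (freeW_ext (f1 := fun g => weval a (wmul (word F k) g))
  (f2 := fun g => weval a (word F k) * weval a g)).
- by move=> c ? ?; rewrite wmul_linearr linearP.
- by move=> c ? ?; rewrite linearP mulrDr scalerAr.
case: k => [[p s] wn] [[[v0 j] t] vm].
rewrite !weval_word (big_cons _ _ (v0, j)) [(_, _).1]/=.
rewrite -[wmul _ _]/(freeW_mul _ _) /freeW_mul !freeW_lift_word /word_mul weval_lift.
set P := \prod_(q <- _ :: _) _; set Q := \prod_(q <- t) _.
have -> : P * ut2_basis F wn * (ut2_basis F v0 * a (v0, j).2 * Q * ut2_basis F vm)
    = P * (ut2_basis F wn * ut2_basis F v0) * a j * Q * ut2_basis F vm.
  by rewrite !mulrA.
rewrite [ut2_basis F wn * ut2_basis F v0 in RHS]ut2_coordE mulr_sumr !mulr_suml.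
apply: eq_bigr => b _; rewrite weval_word -cat_cons prod_cat_cons -/P -/Q.
by rewrite -scalerAr -!scalerAl !mulrA.
Qed.

Lemma weval_wvar a i : weval a (wvar F i) = a i.
Proof. by rewrite /wvar weval_word big_seq1 /= mul1r mulr1. Qed.

Lemma weval_wmonomial a (l : seq (UT2 F * freeW F)) w :
  weval a (wmonomial l w) = wmonomial [seq (p.1, weval a p.2) | p <- l] w.
Proof.
case: l => [|p l]; first exact: linear0.
rewrite /wmonomial /= weval_ract; congr (_ * w).
rewrite -[wlact p.1 (weval a p.2)]/(p.1 * weval a p.2) -weval_lact; elim: l (wlact p.1 p.2) => //= q l IHl x.
by rewrite IHl weval_mul weval_lact.
Qed.

Lemma weval_comp a (b : nat -> freeW F) f :
  weval a (weval b f) = weval (fun i => weval a (b i)) f.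
Proof.
apply: (freeW_ext (f1 := fun f => weval a (weval b f))
  (f2 := weval (fun i => weval a (b i)))).
- by move=> c g h; rewrite /weval (freeW_lift_linear _ c g h) linearP.
- by move=> c g h; rewrite linearP.
move=> [[p s] wn]; rewrite [weval b _]freeW_lift_word weval_wmonomial.
by rewrite [RHS]freeW_lift_word -map_comp.
Qed.

End Evaluation.

(** * Generalized multilinear polynomials modulo identities *)

Lemma big_enum_noncomm (R : Type) (x : R) (op : R -> R -> R) (I : finType) (G : I -> R) :
  \big[op/x]_(k <- enum I) G k = \big[op/x]_k G k.
Proof. by rewrite [index_enum I]unlock enumT. Qed.

Section GeneralizedPolynomials.
Variables (F : fieldType) (n : nat) (n_gt0 : (0 < n)%N).
Implicit Types (f g : freeW F) (a : nat -> UT2 F) (w : nat -> UT2 F) (s : 'S_n).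
Implicit Types (om : {ffun 'I_n -> 'I_3}).

Definition gmonomial s w : freeW F :=
  wmonomial [seq (w k, wvar F (s k)) | k : 'I_n] (w n).

Definition letter_val om a : F := \prod_(i < n) ut2_entry (om i) (a i).

(** The evaluation point that separates the monomials [letter_val]: by [letter_val_assign], only the
    one of om takes the value 1 there, and all others vanish. *)
Definition assign om (i : nat) : UT2 F :=
  if insub i is Some j then ut2_letter F (om j) else 0.

Lemma assign_ord om (i : 'I_n) : assign om i = ut2_letter F (om i).
Proof. by rewrite /assign valK. Qed.

Lemma GP_ind (P : freeW F -> Prop) : P 0 ->
  (forall c f g, P f -> P g -> P (c *: f + g)) -> (forall s w, P (gmonomial s w)) ->
  forall f, GP n f -> P f.
Proof.
move=> P0 PS Pm f [m [c [s [w ->]]]].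
by apply: (big_rec P) => // i g _ Pg; apply: PS Pg; apply: Pm.
Qed.

Lemma GP_gmonomial s w : GP n (gmonomial s w).
Proof.
exists 1%N, (fun=> 1), (fun=> s), (fun=> w).
by rewrite big_ord1 scale1r.
Qed.

Lemma weval_gmonomial a s w :
  weval a (gmonomial s w) = (\prod_(k < n) (w k * a (s k))) * w n.
Proof.
rewrite weval_wmonomial wmonomial_ut2; last first.
  by rewrite -size_eq0 !size_map -enumT size_enum_ord -lt0n.
rewrite -map_comp big_map big_enum_noncomm /=; congr (_ * _).
by apply: eq_bigr => k _; rewrite weval_wvar.
Qed.

Lemma GP_expand f a : GP n f ->
  weval a f = \sum_om letter_val om a *: weval (assign om) f.
Proof.
move: f; apply: GP_ind => [|c f g IHf IHg|s w].
- by rewrite weval0 big1 // => om _; rewrite weval0 scaler0.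
- rewrite wevalP IHf IHg scaler_sumr -big_split; apply: eq_bigr => om _ /=.
  by rewrite wevalP scalerDr !scalerA mulrC.
rewrite weval_gmonomial.
transitivity ((\prod_(k < n) \sum_t
    ut2_entry t (a (s k)) *: (w k * ut2_letter F t)) * w n).
  congr (_ * _); apply: eq_bigr => k _; rewrite [a (s k) in LHS]ut2_unitE mulr_sumr.
  by apply: eq_bigr => t _; rewrite scalerAr.
rewrite bigA_distr_bigA mulr_suml /=.
pose h om : {ffun 'I_n -> 'I_3} := [ffun k => om (s k)].
have h_inj : injective h.
  move=> om om' /ffunP e; apply/ffunP => x; have := e (s^-1 x)%g.
  by rewrite !ffunE permKV.
rewrite (reindex h) /=; last exact: onW_bij (injF_bij h_inj).
apply: eq_bigr => om _; rewrite weval_gmonomial scaler_prod scalerAl.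
congr (_ *: _ * _).
  rewrite /letter_val [RHS](reindex_inj (@perm_inj _ s)) /=.
  by apply: eq_bigr => k _; rewrite ffunE.
by apply: eq_bigr => k _; rewrite ffunE assign_ord.
Qed.

Lemma ut2_entry_prod t (I : finType) (G : I -> UT2 F) : t != o2 ->
  ut2_entry t (\prod_i G i) = \prod_i ut2_entry t (G i).
Proof.
move=> t2; apply: (big_morph (ut2_entry t)).
  move=> u v; have [M0 M1 _] := ut2_entryM u v.
  by elim/ord3P: t t2.
by rewrite /ut2_entry ut2_mx1; elim/ord3P: t t2; rewrite //= mxE.
Qed.

Lemma ut2_entryMl t (u v : UT2 F) : t != o2 ->
  ut2_entry t (u * v) = ut2_entry t u * ut2_entry t v.
Proof. by have [M0 M1 _] := ut2_entryM u v; elim/ord3P: t. Qed.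

(** Diagonal entries are multiplicative, so one variable whose letter differs from t annihilates the
    entry. *)
Lemma GP_entry_eq0 f om t : GP n f -> t != o2 -> om != [ffun=> t] ->
  ut2_entry t (weval (assign om) f) = 0.
Proof.
move=> Gf t2 nom; move: f Gf; apply: GP_ind => [|c f g f0 g0|s w].
- by rewrite weval0 ut2_entry0.
- by rewrite wevalP ut2_entryP f0 g0 mulr0 addr0.
have [i nti] : exists i, om i != t.
  apply/existsP; apply: contraNT nom; rewrite negb_exists => /forallP h.
  by apply/eqP/ffunP => i; rewrite ffunE; apply/eqP; have := h i; rewrite negbK.
rewrite weval_gmonomial ut2_entryMl // ut2_entry_prod // (bigD1 (s^-1 i)%g) //=.
rewrite ut2_entryMl // permKV assign_ord ut2_entry_letter eq_sym (negPf nti).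
by rewrite mulr0 !mul0r.
Qed.

(** Two variables are sent to strictly upper matrices, and a product with two such factors is 0. *)
Lemma GP_eq0 f om : GP n f -> (1 < content om o2)%N -> weval (assign om) f = 0.
Proof.
move=> Gf om2; move: f Gf; apply: GP_ind => [|c f g f0 g0|s w].
- exact: weval0.
- by rewrite wevalP f0 g0 scaler0 addr0.
rewrite weval_gmonomial.
have -> : \prod_(k < n) (w k * assign om (s k))
    = \prod_(u <- [seq w k * assign om (s k) | k : 'I_n]) u.
  by rewrite big_map big_enum_noncomm.
rewrite strictly_upper_prod0 ?mul0r // count_map.
apply: leq_trans om2 _; rewrite -sum1_count big_enum_cond sum1_card.
rewrite -[leqLHS](card_perm_comp s (fun x => om x == o2)); apply: subset_leq_card.
apply/subsetP => k; rewrite !inE /= => /eqP ok; rewrite unfold_in /= assign_ord ok.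
apply: strictly_upperMr.
by rewrite /strictly_upper !ut2_entry_letter !eqxx.
Qed.
End GeneralizedPolynomials.

Section GPBasis.
Variables (F : fieldType) (n : nat) (n_gt0 : (0 < n)%N).
Implicit Types (f g : freeW F) (a : nat -> UT2 F) (w : nat -> UT2 F) (s : 'S_n).
Implicit Types (om : {ffun 'I_n -> 'I_3}).

Definition few_o2 : {pred {ffun 'I_n -> 'I_3}} := [pred om | (content om o2 <= 1)%N].

(* [inl false], [inl true] and [inr om] index the functions [prod_i a_i(1,1) e_11],  *)
(* [prod_i a_i(2,2) e_22] and [letter_val om a e_12] of a.                           *)
Definition gp_index : finType := (bool + {om in few_o2})%type.
Implicit Types j k : gp_index.

Definition gp_word j : {ffun 'I_n -> 'I_3} :=
  match j with
  | inl b => [ffun=> if b then o1 else o0]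
  | inr om => val om
  end.

Definition gp_letter j : 'I_3 :=
  match j with inl b => if b then o1 else o0 | inr _ => o2 end.

Definition gp_coef j f : F := ut2_entry (gp_letter j) (weval (assign F (gp_word j)) f).

Definition gp_val j a : UT2 F := letter_val (gp_word j) a *: ut2_letter F (gp_letter j).

(** What is retained of membership in GP_n: it suffices for [GIdP] and is visibly stable under
    linear combinations and renaming. *)
Definition gp_good f : Prop := forall a, weval a f = \sum_j gp_coef j f *: gp_val j a.

Lemma gp_coefP j c f g : gp_coef j (c *: f + g) = c * gp_coef j f + gp_coef j g.
Proof. by rewrite /gp_coef wevalP ut2_entryP. Qed.

Lemma gp_coef0 j : gp_coef j 0 = 0.
Proof. by rewrite /gp_coef weval0 ut2_entry0. Qed.

Lemma gp_goodP c f g : gp_good f -> gp_good g -> gp_good (c *: f + g).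
Proof.
move=> gf gg a; rewrite wevalP gf gg scaler_sumr -big_split; apply: eq_bigr => j _ /=.
by rewrite gp_coefP scalerDl scalerA.
Qed.

Lemma gp_good0 : gp_good 0.
Proof. by move=> a; rewrite weval0 big1 // => j _; rewrite gp_coef0 scale0r. Qed.

Lemma GP_good f : GP n f -> gp_good f.
Proof.
move=> Gf a; rewrite (GP_expand n_gt0 a Gf); apply: ut2_entry_inj => t.
rewrite !ut2_entry_sum big_sumType big_bool /=.
under eq_bigr => om _ do rewrite ut2_entryZ.
rewrite /gp_val /= !ut2_entryZ !ut2_entry_letter.
under [in RHS]eq_bigr => om _ do rewrite !ut2_entryZ ut2_entry_letter.
have [t2|nt2] := eqVneq t o2.
  rewrite t2 /= !mulr0 !add0r.
  rewrite (bigID (fun om => om \in few_o2)) /= [X in _ + X]big1 ?addr0; last first.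
    by move=> om; rewrite inE -ltnNge => om2; rewrite GP_eq0 // ut2_entry0 mulr0.
  rewrite (big_sub _ (fun om => letter_val om a * ut2_entry o2 (weval (assign F om) f))).
  by apply: eq_bigr => om _; rewrite mulr1 mulrC.
rewrite [X in _ = _ + X]big1 ?addr0; last by move=> om _; rewrite !mulr0.
rewrite (bigD1 [ffun=> t]) //= [X in _ + X]big1 ?addr0; last first.
  by move=> om nom; rewrite GP_entry_eq0 // mulr0.
have [->|->] : t = o0 \/ t = o1 by elim/ord3P: t nt2 => //; [left | right].
  by rewrite (_ : (o0 == o1) = false) // eqxx !mulr0 mulr1 add0r; apply: mulrC.
by rewrite (_ : (o1 == o0) = false) // eqxx !mulr0 mulr1 addr0; apply: mulrC.
Qed.

Lemma GIdP f : gp_good f -> (GId (UT2 F) f <-> forall j, gp_coef j f = 0).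
Proof.
move=> gf; split=> [idf j|c0 a]; first by rewrite /gp_coef idf ut2_entry0.
by rewrite gf big1 // => j _; rewrite c0 scale0r.
Qed.

Definition word_act s om : {ffun 'I_n -> 'I_3} := [ffun x => om (s x)].

Lemma content_act s om : content (word_act s om) =1 content om.
Proof.
move=> t; rewrite -[RHS](card_perm_comp s (fun x => om x == t)).
by apply: eq_card => x; rewrite !inE ffunE.
Qed.

Lemma few_o2_act s om : (word_act s om \in few_o2) = (om \in few_o2).
Proof. by rewrite !inE content_act. Qed.

Definition gp_act s j : gp_index :=
  match j with
  | inl b => inl b
  | inr om => inr (Sub (word_act s (val om))
                    (etrans (few_o2_act s (val om)) (valP om)))
  end.

Lemma gp_actM s t j : gp_act (s * t) j = gp_act s (gp_act t j).
Proof.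
case: j => // om; congr inr; apply: val_inj => /=.
by apply/ffunP => x; rewrite !ffunE permM.
Qed.

Lemma gp_act1 j : gp_act 1 j = j.
Proof.
case: j => // om; congr inr; apply: val_inj => /=.
by apply/ffunP => x; rewrite !ffunE perm1.
Qed.

Lemma gp_act_bij s : bijective (gp_act s).
Proof.
by exists (gp_act s^-1) => j; rewrite -gp_actM (mulgV, mulVg) gp_act1.
Qed.

Lemma gp_word_act s j : gp_word (gp_act s j) = word_act s (gp_word j).
Proof. by case: j => // b; apply/ffunP => x; rewrite !ffunE. Qed.

Lemma gp_letter_act s j : gp_letter (gp_act s j) = gp_letter j.
Proof. by case: j. Qed.

Definition ext_perm s (i : nat) : nat := if insub i is Some x then s x else i.

Lemma ext_perm_ord s (x : 'I_n) : ext_perm s x = s x.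
Proof. by rewrite /ext_perm valK. Qed.

Lemma weval_wrename a s f : weval a (wrename s f) = weval (fun i => a (ext_perm s i)) f.
Proof.
rewrite /wrename weval_comp /weval; apply: eq_freeW_lift => -[[p t] wn].
by congr wmonomial; apply: eq_map => q; rewrite -/(weval a _) weval_wvar.
Qed.

Lemma eq_weval a (b : nat -> UT2 F) f : a =1 b -> weval a f = weval b f.
Proof.
move=> ab; apply: eq_freeW_lift => -[[p t] wn]; congr wmonomial.
by apply: eq_map => q; rewrite ab.
Qed.

Lemma assign_act s om i : assign F om (ext_perm s i) = assign F (word_act s om) i.
Proof.
have [lti|gei] := ltnP i n.
  by rewrite -[i]/(val (Ordinal lti)) ext_perm_ord !assign_ord ffunE.
by rewrite /ext_perm insubN -?leqNgt // /assign insubN -?leqNgt.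
Qed.

Lemma gp_coef_rename j s f : gp_coef j (wrename s f) = gp_coef (gp_act s j) f.
Proof.
rewrite /gp_coef weval_wrename gp_letter_act gp_word_act.
by rewrite (eq_weval f (assign_act s (gp_word j))).
Qed.

Lemma gp_good_rename s f : gp_good f -> gp_good (wrename s f).
Proof.
move=> gf a; rewrite weval_wrename gf (reindex (gp_act s)) /=; last first.
  exact: onW_bij (gp_act_bij s).
apply: eq_bigr => j _; rewrite gp_coef_rename /gp_val gp_letter_act gp_word_act.
congr (_ *: (_ *: _)); rewrite /letter_val [RHS](reindex_inj (@perm_inj _ s)) /=.
by apply: eq_bigr => x _; rewrite ffunE ext_perm_ord.
Qed.

Lemma letter_val_assign om om' : letter_val om (assign F om') = (om == om')%:R.
Proof.
rewrite /letter_val; under eq_bigr do rewrite assign_ord ut2_entry_letter.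
have [->|nom] := eqVneq om om'; first by rewrite big1 // => i _; rewrite eqxx.
have [i /negPf ni] : exists i, om i != om' i.
  apply/existsP; apply: contraNT nom; rewrite negb_exists => /forallP h.
  by apply/eqP/ffunP => i; apply/eqP; have := h i; rewrite negbK.
by rewrite (bigD1 i) //= ni mul0r.
Qed.

Lemma gp_coef_val j k f : (forall a, weval a f = gp_val k a) -> gp_coef j f = (j == k)%:R.
Proof.
move=> fk; rewrite /gp_coef fk /gp_val ut2_entryZ letter_val_assign ut2_entry_letter.
rewrite -natrM mulnb; congr ((_ : bool)%:R).
apply/andP/eqP => [[/eqP ew /eqP el]|->]; last by rewrite !eqxx.
case: j k ew el {fk} => [b|om] [b'|om'] //=; last by move=> /val_inj ->.
- by case: b; case: b'.
- by case: b.
- by case: b'.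
Qed.

Section MatrixUnitChain.
Variables (tau : nat -> 'I_3) (i0 : bool).

(** The index reached by the chain before the k-th variable. *)
Let st (k : nat) := if k is k'.+1 then letter_col (tau k') else i0.

Lemma ut2_unit_chain (u : nat -> UT2 F) m x :
  (forall k : nat, (k < m)%N -> st k ==> letter_row (tau k)) -> st m ==> x ->
  (\prod_(k < m) (ut2_unit F (st k) (letter_row (tau k)) * u k)) * ut2_unit F (st m) x
    = (\prod_(k < m) ut2_entry (tau k) (u k)) *: ut2_unit F i0 x.
Proof.
elim: m x => [|m IHm] x stm stx; first by rewrite !big_ord0 mul1r scale1r.
rewrite !big_ord_recr /= -mulrA ut2_unit_sandwich ?stm //.
rewrite -scalerAr IHm ?scalerA 1?mulrC // => [k ltk|].
  by apply: stm; apply: ltnW.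
have := stm m (ltnSn m); move: stx => /=.
by case: (st m) x => [] [] //=; elim/ord3P: (tau m).
Qed.

Lemma GP_unit_chain om s (j0 : bool) : (forall k : 'I_n, tau k = om (s k)) ->
  (forall k : nat, (k < n)%N -> st k ==> letter_row (tau k)) -> st n ==> j0 ->
  exists2 f, GP n f & forall a, weval a f = letter_val om a *: ut2_unit F i0 j0.
Proof.
move=> tauE stn stj.
(* Each coefficient leads from the column of one letter to the row of the next; the last one, of
   index n, leads to j0. *)
exists (gmonomial s (fun k : nat => ut2_unit F (st k) (if k == n then j0 else letter_row (tau k)))).
  exact: GP_gmonomial.
pose ext (a : nat -> UT2 F) (i : nat) : UT2 F :=
  if insub i is Some x then a ((s : 'S_n) x) else 0.
move=> a; rewrite weval_gmonomial // eqxx.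
have -> : letter_val om a = \prod_(k < n) ut2_entry (tau k) (ext a k).
  rewrite /letter_val (reindex_inj (@perm_inj _ s)) /=; apply: eq_bigr => k _.
  by rewrite tauE /ext valK.
rewrite -ut2_unit_chain //; congr (_ * _); apply: eq_bigr => k _.
by rewrite ltn_eqF // /ext valK.
Qed.

End MatrixUnitChain.

(* Ordering the variables so that their letters come in the order o0, o2, o1 makes *)
(* a product of matrix units that is nonzero only on these letters.                *)
Lemma GP_few_o2 om : om \in few_o2 ->
  exists2 f, GP n f & forall a, weval a f = letter_val om a *: ut2_letter F o2.
Proof.
rewrite inE => om2; pose rank (t : 'I_3) := nth 0%N [:: 0; 2; 1]%N t.
pose r (t u : 'I_3) := (rank t <= rank u)%N.
pose l := [tuple om i | i < n].
have /tuple_permP[s sE] : perm_eq (sort_tuple r l) l by rewrite /= perm_sort.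
have srt : sorted r (sort r l) by apply: sort_sorted => t u; apply: leq_total.
have szs : size (sort r l) = n by rewrite size_sort size_tuple.
have tauE (k : 'I_n) : nth o0 (sort r l) k = om (s k).
  have -> : sort r l = [tuple tnth l (s i) | i < n] :> seq _ := sE.
  by rewrite -tnth_nth !tnth_mktuple.
have srow (k : nat) : (k.+1 < n)%N ->
    letter_col (nth o0 (sort r l) k) ==> letter_row (nth o0 (sort r l) k.+1).
  move=> ltk; have ltk' := ltnW ltk.
  have /(sortedP o0) h := srt; have := h k; rewrite szs => /(_ ltk).
  have := tauE (Ordinal ltk); have := tauE (Ordinal ltk') => /= -> ->.
  (* The only sorted pair of letters that breaks the chain is [o2], [o2], which a single [o2]
     excludes. *)
  set x := s _; set y := s _ => rxy; apply/implyP => cx; apply: contraLR om2 => ry.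
  have [ex ey] : om x = o2 /\ om y = o2.
    by move: rxy cx ry; rewrite /r /rank; elim/ord3P: (om x); elim/ord3P: (om y).
  rewrite -ltnNge; apply/card_gt1P; exists x, y; rewrite !inE ex ey; split=> //.
  by apply/eqP => /perm_inj/(congr1 val) /= /n_Sn.
apply: (@GP_unit_chain (nth o0 (sort r l)) false om s true) => //.
  by case=> [|k] // ltk; apply: srow.
by rewrite implybT.
Qed.

Lemma gp_basis k : exists2 f, GP n f & forall a, weval a f = gp_val k a.
Proof.
case: k => [b|[om om2]]; last exact: GP_few_o2.
pose t := if b then o1 else o0; have tb : letter_row t = b /\ letter_col t = b.
  by rewrite /t; case: (b).
case: tb => tr tc; rewrite /gp_val /= -/t /ut2_letter tr tc.
apply: (@GP_unit_chain (fun=> t) b _ 1%g).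
- by move=> k; rewrite ffunE.
- by case=> [|k] _; rewrite ?tr ?tc implybb.
by case: (n) n_gt0 => // m _; rewrite tc implybb.
Qed.

End GPBasis.

(** * The permutation module and its character *)

Section GPCharacter.
Variables (F : fieldType) (n : nat) (n_gt0 : (0 < n)%N).
Implicit Types (s t : 'S_n) (j k : gp_index n) (f g : freeW F).
Local Notation N := #|gp_index n|.

(** Row i holds the coordinates of the renamed i-th basis element, as given by [gp_coef_rename]. *)
Definition gp_perm_mx s : 'M[F]_N :=
  \matrix_(i, j) (enum_val i == gp_act s (enum_val j))%:R.

Lemma gp_perm_mx_repr : mx_repr [set: 'S_n] gp_perm_mx.
Proof.
split=> [|s t _ _]; apply/matrixP => i j; rewrite !mxE.
  by rewrite gp_act1 (inj_eq enum_val_inj).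
rewrite (bigD1 (enum_rank (gp_act t (enum_val j)))) //= !mxE enum_rankK eqxx mulr1.
rewrite -gp_actM big1 ?addr0 // => k nk; rewrite !mxE.
suff /negPf -> : enum_val k != gp_act t (enum_val j) by rewrite mulr0.
by apply: contra nk => /eqP <-; rewrite enum_valK.
Qed.

Canonical gp_perm_repr := MxRepresentation gp_perm_mx_repr.

Lemma mxtrace_gp_perm s : \tr (gp_perm_mx s) = #|[pred j | gp_act s j == j]|%:R.
Proof.
transitivity (\sum_j (gp_act s j == j)%:R : F).
  rewrite [RHS](reindex (@enum_val _ (mem (gp_index n)))) /=; last first.
    exact: onW_bij (enum_val_bij _).
  by apply: eq_bigr => i _; rewrite mxE eq_sym.
rewrite -sum1_card natr_sum [RHS]big_mkcond; apply: eq_bigr => j _.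
by rewrite inE; case: eqP.
Qed.

Lemma GP_sum d (c : 'I_d -> F) (e : 'I_d -> freeW F) :
  (forall i, gp_good n (e i)) -> gp_good n (\sum_i c i *: e i).
Proof.
move=> ge; apply: (big_rec (@gp_good F n)) => [|i f _ gf]; first exact: gp_good0.
exact: gp_goodP (ge i) gf.
Qed.

Lemma gp_coef_sum d (c : 'I_d -> F) (e : 'I_d -> freeW F) j :
  gp_coef j (\sum_i c i *: e i) = \sum_i c i * gp_coef j (e i).
Proof.
apply: (big_rec2 (fun f x => gp_coef j f = x)) => [|i f x _ <-]; first exact: gp_coef0.
exact: gp_coefP.
Qed.

Lemma gp_coefB f g j : gp_coef j (f - g) = gp_coef j f - gp_coef j g.
Proof. by rewrite addrC -scaleN1r gp_coefP mulN1r addrC. Qed.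

Lemma gp_goodB f g : gp_good n f -> gp_good n g -> gp_good n (f - g).
Proof. by move=> gf gg; rewrite addrC -scaleN1r; apply: gp_goodP. Qed.

Lemma affords_gp_perm : affords_GP (UT2 F) gp_perm_repr.
Proof.
have [e Ge ev] := fin_all_exists2 (@gp_basis F n n_gt0).
have coef_e j k : gp_coef j (e k) = (j == k)%:R by apply: gp_coef_val; apply: ev.
have good_e (i : 'I_N) : gp_good n (e (enum_val i)) by apply: GP_good.
have coef_sum (c : 'I_N -> F) i : gp_coef (enum_val i) (\sum_i c i *: e (enum_val i)) = c i.
  rewrite gp_coef_sum (bigD1 i) //= coef_e eqxx mulr1 big1 ?addr0 // => k nk.
  by rewrite coef_e (inj_eq enum_val_inj) eq_sym (negPf nk) mulr0.
have GId0 f : gp_good n f -> (forall i : 'I_N, gp_coef (enum_val i) f = 0) ->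
    GId (UT2 F) f.
  by move=> gf c0; apply/(GIdP gf) => j; rewrite -[j]enum_rankK.
exists (fun i => e (enum_val i)); split=> [i|f Gf|c idc i|s i].
- exact: Ge.
- exists (fun i => gp_coef (enum_val i) f); apply: GId0 => [|i].
    by apply: gp_goodB; [apply: GP_good | apply: GP_sum].
  by rewrite gp_coefB coef_sum subrr.
- by rewrite -(coef_sum c i); apply: (GIdP (GP_sum c good_e)).1.
apply: GId0 => [|j].
  by apply: gp_goodB; [apply: gp_good_rename | apply: GP_sum].
rewrite gp_coefB coef_sum gp_coef_rename coef_e mxE eq_sym.
exact: subrr.
Qed.

(* The coordinates of the classes e_i in the basis indexed by [gp_index n] form an   *)
(* invertible matrix, which intertwines [rG] with [gp_perm_mx].                       *)
Lemma affords_mxtrace d (rG : mx_representation F [set: 'S_n] d) s :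
  affords_GP (UT2 F) rG -> \tr (rG s) = \tr (gp_perm_mx s).
Proof.
case=> e [Ge span free act].
have good_e i : gp_good n (e i) by apply: GP_good.
have [b Gb bv] := fin_all_exists2 (@gp_basis F n n_gt0).
have [c idc] := fin_all_exists (fun j => span (b j) (Gb j)).
pose C : 'M[F]_(d, N) := \matrix_(i, j) gp_coef (enum_val j) (e i).
pose D : 'M[F]_(N, d) := \matrix_(j, i) c (enum_val j) i.
have DC : D *m C = 1%:M.
  apply/matrixP => i j; rewrite !mxE.
  have /(GIdP (gp_goodB (GP_good n_gt0 (Gb _)) (GP_sum _ good_e))) := idc (enum_val i).
  move/(_ (enum_val j)) => /eqP; rewrite gp_coefB gp_coef_sum subr_eq0 => /eqP cb.
  transitivity (gp_coef (enum_val j) (b (enum_val i))).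
    by rewrite cb; apply: eq_bigr => k _; rewrite !mxE.
  rewrite (@gp_coef_val _ _ _ (enum_val i)); last exact: bv.
  by rewrite (inj_eq enum_val_inj) eq_sym.
(* C is not known to be square. As E *m C = 0, each row of E gives a combination of the e_i with
   zero coordinates, hence an identity, and the e_i are free modulo identities. *)
have CD : C *m D = 1%:M.
  apply/eqP; rewrite -subr_eq0; apply/eqP; set E := _ - _.
  have EC : E *m C = 0 by rewrite mulmxBl -mulmxA DC mulmx1 mul1mx subrr.
  apply/matrixP => i k; rewrite [RHS]mxE; move: k.
  apply: free; apply: (GIdP (GP_sum (E i) good_e)).2 => j; rewrite gp_coef_sum.
  have := congr1 (fun M : 'M_(d, N) => M i (enum_rank j)) EC; rewrite !mxE => EC0.
  by rewrite -[RHS]EC0; apply: eq_bigr => k _; rewrite !mxE enum_rankK.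
have CP : rG s *m C = C *m gp_perm_mx s.
  apply/matrixP => i j; rewrite !mxE.
  have gd := gp_goodB (gp_good_rename s (good_e i)) (GP_sum (rG s i) good_e).
  have /(GIdP gd)/(_ (enum_val j))/eqP := act s i.
  rewrite gp_coefB gp_coef_sum gp_coef_rename subr_eq0 => /eqP rs.
  transitivity (gp_coef (gp_act s (enum_val j)) (e i)).
    by rewrite rs; apply: eq_bigr => k _; rewrite !mxE.
  rewrite (bigD1 (enum_rank (gp_act s (enum_val j)))) //= !mxE enum_rankK eqxx mulr1.
  rewrite big1 ?addr0 // => k nk; rewrite !mxE.
  suff /negPf -> : enum_val k != gp_act s (enum_val j) by rewrite mulr0.
  by apply: contra nk => /eqP <-; rewrite enum_valK.
by rewrite -[rG s]mulmx1 -CD mulmxA CP -mulmxA mxtrace_mulC -mulmxA DC mulmx1.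
Qed.

Lemma nfix_eq0 (f : 'I_3 -> nat) s : (\sum_i f i != n)%N -> nfix f s = 0%N.
Proof.
move=> fn; apply: eq_card0 => om; rewrite !inE; apply/negP => /andP[/has_contentP ce _].
by case/eqP: fn; rewrite -[RHS](content_sum om); apply: eq_bigr => i _.
Qed.

Lemma nfix_n00 s : nfix (c3 n 0 0) s = 1%N.
Proof.
apply: etrans (card1 ([ffun=> o0] : {ffun 'I_n -> 'I_3})); apply: eq_card => om.
apply/andP/eqP => [[/has_contentP ce _]|->].
  apply/ffunP => x; rewrite ffunE.
  have := card0_eq (ce o1) x; have := card0_eq (ce o2) x.
  by rewrite !inE; elim/ord3P: (om x).
split; last by apply/wstabP => x; rewrite !ffunE.
apply/has_contentP => i; rewrite /content.
elim/ord3P: i; [rewrite -[RHS](card_ord n); apply: eq_card => x | |];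
  by [rewrite !inE ffunE | apply: eq_card0 => x; rewrite !inE ffunE].
Qed.

(** The two diagonal indices are always fixed; the words are sorted by their number of letters [o2],
    then of letters [o0]. *)
Lemma card_gp_fixed s : #|[pred j | gp_act s j == j]|%:Z
  = 2 * hfix (n, 0, 0)%N s + \sum_(k < n.+1) hfix (k : nat, n - k, 0)%N s
    + \sum_(k < n) hfix (k : nat, n.-1 - k, 1)%N s.
Proof.
have lt_content (om : {ffun 'I_n -> 'I_3}) : (content om o0 < n.+1)%N.
  by rewrite ltnS -{2}(card_ord n) max_card.
have by_o2 (e : nat) : (\sum_(om : {ffun 'I_n -> 'I_3} | content om o2 == e) (s \in wstab om)
    = \sum_(k < n.+1) nfix (c3 k (n - e - k) e) s)%N.
  rewrite (partition_big (fun om => Ordinal (lt_content om)) xpredT) //=.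
  apply: eq_bigr => k _; rewrite nfixE; apply: eq_bigl => om.
  rewrite /has_content forall_ord3 -val_eqE /= /c3 /=.
  have := content_sum om; rewrite sum_ord3 => cn.
  by apply/andP/and3P => [[/eqP e2 /eqP e0]|[/eqP e0 /eqP e1 /eqP e2]]; split;
    apply/eqP; rewrite ?e0 ?e2 //; lia.
have -> : #|[pred j | gp_act s j == j]|
    = (2 + (\sum_(k < n.+1) nfix (c3 k (n - 0 - k) 0) s
          + \sum_(k < n.+1) nfix (c3 k (n - 1 - k) 1) s))%N.
  rewrite -!by_o2 -sum1_card big_mkcond big_sumType big_bool; congr (_ + _)%N.
  transitivity (\sum_(om in @few_o2 n) (s \in wstab om))%N.
    rewrite [RHS]big_sub; apply: eq_bigr => om _.
    rewrite -[_ \in _]/(gp_act s (inr om) == inr om).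
    have -> : (gp_act s (inr om) == inr om) = (s \in wstab (val om)).
      apply/eqP/wstabP => [[e] x|e]; first by rewrite -[in RHS]e ffunE.
      by congr inr; apply: val_inj; apply/ffunP => x; rewrite ffunE e.
    by case: (_ \in _).
  rewrite (bigID (fun om => content om o2 == 0%N)) /=; congr (_ + _)%N.
    by apply: eq_bigl => om; rewrite inE; case: (content om o2) => [|[]].
  by apply: eq_bigl => om; rewrite inE; case: (content om o2) => [|[]].
(* With one letter [o2] the index k = n is impossible: by truncation its content adds up to n +
   1. *)
rewrite [X in (_ + (_ + X))%N]big_ord_recr /= nfix_eq0 ?addn0; last first.
  by rewrite sum_ord3 /c3 /=; lia.
rewrite /hfix /= nfix_n00 !PoszD -addrA; congr (_ + (_ + _)).
  by rewrite -natz natr_sum; apply: eq_bigr => k _; rewrite natz subn0.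
by rewrite -natz natr_sum; apply: eq_bigr => k _; rewrite natz subn1.
Qed.

End GPCharacter.

(** * The generalized cocharacter and its multiplicities *)

Lemma gcocharacterP (F : fieldType) (n : nat) (chi : 'S_n -> F) :
  [pchar F] =i pred0 -> (0 < n)%N ->
  is_gcocharacter (UT2 F) chi
    <-> forall s, chi s = \sum_(la : intpart n) (gen_mult la)%:R * irr_char F la s.
Proof.
move=> char0 n_gt0.
have trE s : \tr (gp_perm_mx F s)
    = \sum_(la : intpart n) (gen_mult la)%:R * irr_char F la s.
  by rewrite sum_gen_mult_irr_char // -card_gp_fixed // mxtrace_gp_perm.
split=> [[d [rG [aff chiE]]] s|chiE].
  by rewrite chiE (affords_mxtrace n_gt0 _ aff) trE.
exists #|gp_index n|, (gp_perm_repr F n); split; first exact: affords_gp_perm.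
by move=> s; rewrite chiE -trE.
Qed.

Lemma gen_multP (n : nat) (m : intpart n -> nat) : (0 < n)%N ->
  (m =1 @gen_mult n)
  <->
  [/\ forall la : intpart n, la = [:: n] :> seq nat -> m la = (2 * n + 3)%N,
      forall (la : intpart n) (p q : nat), (1 <= p)%N ->
        la = [:: p + q; p]%N :> seq nat -> m la = (3 * (q + 1))%N,
      forall (la : intpart n) (p q : nat), (1 <= p)%N ->
        la = [:: p + q; p; 1]%N :> seq nat -> m la = (q + 1)%N
    & forall la : intpart n,
        la <> [:: n] :> seq nat ->
        (forall p q : nat, (1 <= p)%N -> la <> [:: p + q; p]%N :> seq nat) ->
        (forall p q : nat, (1 <= p)%N -> la <> [:: p + q; p; 1]%N :> seq nat) ->
        m la = 0%N].
Proof.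
move=> n_gt0.
have shape (la : intpart n) : [\/ la = [:: n] :> seq nat,
    exists p q : nat, (1 <= p)%N /\ la = [:: p + q; p]%N :> seq nat,
    exists p q : nat, (1 <= p)%N /\ la = [:: p + q; p; 1]%N :> seq nat
  | [/\ gen_mult la = 0%N, la <> [:: n] :> seq nat,
        forall p q : nat, (1 <= p)%N -> la <> [:: p + q; p]%N :> seq nat
      & forall p q : nat, (1 <= p)%N -> la <> [:: p + q; p; 1]%N :> seq nat]].
  have sumla := intpart_sum la; have gt0 := @intpart_gt0 _ la.
  have anti := @intpart_nth_anti _ la.
  rewrite /gen_mult; move: (parts la) sumla gt0 anti => l sl gt0 anti.
  case: l => [|a [|b [|c [|d l]]]] in sl gt0 anti *.
  - by move: n_gt0; rewrite -sl.
  - by apply: Or41; rewrite -sl /= addn0.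
  - apply: Or42; exists b, (a - b)%N; split; first exact: (gt0 1%N).
    by rewrite subnKC // (anti 0%N 1%N).
  - have [c1|nc1] := eqVneq c 1%N.
      rewrite c1; apply: Or43; exists b, (a - b)%N; split; first exact: (gt0 1%N).
      by rewrite subnKC // (anti 0%N 1%N).
    apply: Or44; split=> //; first by case: c nc1 {sl gt0 anti} => [|[]].
    by move=> p q _ [_ _ c1]; rewrite c1 eqxx in nc1.
  - by apply: Or44; split=> //; case: c {sl gt0 anti} => [|[]].
split=> [mE|[h1 h2 h3 h4] la].
  split=> [la e|la p q p1 e|la p q p1 e|la e1 e2 e3]; rewrite mE.
  - by rewrite /gen_mult e.
  - by rewrite /gen_mult e addKn.
  - by rewrite /gen_mult e addKn.
  - case: (shape la) => [e|[p [q [p1 e]]]|[p [q [p1 e]]]|[]] //.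
      by case: (e2 _ _ p1 e).
    by case: (e3 _ _ p1 e).
case: (shape la) => [e|[p [q [p1 e]]]|[p [q [p1 e]]]|[g0 e1 e2 e3]].
- by rewrite h1 // /gen_mult e.
- by rewrite (h2 _ _ _ p1 e) /gen_mult e addKn.
- by rewrite (h3 _ _ _ p1 e) /gen_mult e addKn.
by rewrite h4 // g0.
Qed.

Theorem theorem4p4 (F : fieldType) (charF0 : [pchar F] =i pred0)
    (n : nat) (n_gt0 : (0 < n)%N) (m : intpart n -> nat) :
  is_gcocharacter (UT2 F) (fun s : 'S_n =>
    \sum_(la : intpart n) (m la)%:R * irr_char F la s)
  <->
  [/\ forall la : intpart n, la = [:: n] :> seq nat -> m la = (2 * n + 3)%N,
      forall (la : intpart n) (p q : nat), (1 <= p)%N ->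
        la = [:: p + q; p]%N :> seq nat -> m la = (3 * (q + 1))%N,
      forall (la : intpart n) (p q : nat), (1 <= p)%N ->
        la = [:: p + q; p; 1]%N :> seq nat -> m la = (q + 1)%N
    & forall la : intpart n,
        la <> [:: n] :> seq nat ->
        (forall p q : nat, (1 <= p)%N -> la <> [:: p + q; p]%N :> seq nat) ->
        (forall p q : nat, (1 <= p)%N -> la <> [:: p + q; p; 1]%N :> seq nat) ->
        m la = 0%N].
Proof.
apply: iff_trans (gcocharacterP _ charF0 n_gt0) (iff_trans _ (gen_multP m n_gt0)).
split=> [mE la|mE s]; last by apply: eq_bigr => la _; rewrite mE.
(* Linear independence gives equality of the multiplicities in F, and characteristic zero lifts it
   to the natural numbers. *)
have : (m la)%:R - (gen_mult la)%:R = 0 :> F.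
  apply: (irr_char_free charF0 (c := fun la => (m la)%:R - (gen_mult la)%:R)) => s.
  under eq_bigr => mu _ do rewrite mulrBl.
  by rewrite sumrB mE subrr.
move/eqP; rewrite -[(m la)%:R]/((m la)%:Z%:~R) -[(gen_mult la)%:R]/((gen_mult la)%:Z%:~R).
by rewrite -intrB intr_eq0_char0 // subr_eq0 => /eqP[].
Qed.
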